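(* Let $\alpha\in(0,2]$, $|\theta|\le\min\{\alpha,2-\alpha\}$, $a\ge 0$, $\lambda>0$. Let $f\in L^{c}(\mathbb{R})$ be such that $(\mathcal{D}_x^{\alpha,\theta})^{j}f\in L^{c}(\mathbb{R})$ for every $j=0,1,2,\dots$ and such that the series defining $\mathcal{O}_{1,x}^{\alpha,\theta}f$ converges uniformly. Let $\mathcal{S}_{\alpha,\theta}$ be the $\alpha$-stable process, $N$ an independent homogeneous Poisson process with parameter $\lambda$, and $\mathcal{Z}_\alpha(t):=\mathcal{S}_{\alpha,\theta}(at+N(t))$, $t\ge 0$. Then the initial-value problem $$\partial_t u(x,t)=\left[a\,\mathcal{D}_x^{\alpha,\theta}+\lambda\left(I-\mathcal{O}_{1,x}^{\alpha,\theta}\right)\right]u(x,t),\qquad u(x,0)=f(x),\qquad x\in\mathbb{R},\ t\ge 0,$$ is satisfied by the transition semigroup $u(x,t)=\mathcal{T}_t^{\mathcal{Z}}f(x)=\mathbb{E}f(x-\mathcal{Z}_\alpha(t))$ of the process $\mathcal{Z}_\alpha$, which is given by $$\mathcal{T}_t^{\mathcal{Z}}f(x)=e^{-\lambda t}\sum_{k=0}^{\infty}\frac{(\lambda t)^k}{k!}\int_{\mathbb{R}}f(x-y)\,p_{\alpha,\theta}(y,k+at)\,dy .$$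
   Context: Fourier transform: $\mathcal{F}\{f(x);\xi\}=\widetilde f(\xi)=\int_{-\infty}^{+\infty}e^{ix\xi}f(x)\,dx$. $L^{c}(\mathcal{I})$ denotes the space of functions whose Riemann improper integral on the open interval $\mathcal{I}$ converges absolutely. For $\alpha\in(0,2]$ and $|\theta|\le\min\{\alpha,2-\alpha\}$ put $\psi_{\alpha,\theta}(\xi)=|\xi|^{\alpha}e^{i\,\mathrm{sign}(\xi)\theta\pi/2}$. The Riesz-Feller fractional derivative $\mathcal{D}_x^{\alpha,\theta}$ is defined by $\mathcal{F}\{\mathcal{D}_x^{\alpha,\theta}f(x);\xi\}=-\psi_{\alpha,\theta}(\xi)\widetilde f(\xi)$. The fractional shift (exponential) operator is, for $c\in\mathbb{R}$, $$\mathcal{O}_{c,x}^{\alpha,\theta}f(x)=\sum_{n=0}^{\infty}\frac{c^n}{n!}(\mathcal{D}_x^{\alpha,\theta})^{n}f(x),$$ where $(\mathcal{D}_x^{\alpha,\theta})^{n}$ is the $n$-fold iteration; it is defined for $f\in L^c(\mathbb{R})$ with all $(\mathcal{D}_x^{\alpha,\theta})^{j}f\in L^c(\mathbb{R})$, provided that the series converges uniformly. $I$ is the identity operator. $\mathcal{S}_{\alpha,\theta}(t)$, $t\ge0$, is the $\alpha$-stable Lévy process with characteristic function $\mathbb{E}e^{i\xi\mathcal{S}_{\alpha,\theta}(t)}=\exp\{-t\,\psi_{\alpha,\theta}(\xi)\}$, and $p_{\alpha,\theta}(x,t)$ is its transition density (for $t=0$, the Dirac delta at $0$).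
   Formalization: The sign of the jump part is corrected: the equation proved is ∂_t u = [aD − λ(I − O_1)]u, since the printed + sign is false; f is assumed continuous and each D^j f denotes its continuous representative, as the pointwise equation fails if f is altered at a point. *)

(* Defs.v *)
(* World: MathComp-Analysis over Stdlib's real numbers (a realType through
   Rstruct); Coquelicot provides the improper Riemann integral. *)
From HB Require Import structures.
From mathcomp Require Import all_boot all_order all_algebra.
From mathcomp Require Import all_classical all_reals all_analysis.
From mathcomp Require Import complex Rstruct Rstruct_topology.
From Coquelicot Require Coquelicot.

Set Implicit Arguments.
Unset Strict Implicit.
Unset Printing Implicit Defensive.

Import Order.TTheory GRing.Theory Num.Theory numFieldNormedType.Exports.

Local Open Scope classical_set_scope.
Local Open Scope ring_scope.

(* Stdlib's reals, packaged as a realType so that the generic instances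
   (topology, Borel sets, Lebesgue measure) apply. *)
Definition RR : realType := Rdefinitions.R.

Definition cexp (z : RR[i]) : RR[i] :=
  ((expR (complex.Re z) * cos (complex.Im z)) +i*
   (expR (complex.Re z) * sin (complex.Im z)))%C.

Definition minfty : (RR -> Prop) -> Prop :=
  Hierarchy.Rbar_locally Rbar.m_infty.
Definition pinfty : (RR -> Prop) -> Prop :=
  Hierarchy.Rbar_locally Rbar.p_infty.

Definition Lc (f : RR -> RR) : Prop :=
  (forall b c : RR, RInt.ex_RInt (V := Hierarchy.R_NormedModule) f b c) /\
  RInt_gen.ex_RInt_gen (V := Hierarchy.R_NormedModule)
    (fun x : RR => `|f x|) minfty pinfty.

Definition improper (f : RR -> RR) : RR :=
  RInt_gen.RInt_gen (V := Hierarchy.R_CompleteNormedModule) f minfty pinfty.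

Definition fourier (f : RR -> RR) (xi : RR) : RR[i] :=
  (improper (fun x => cos (x * xi) * f x)%R +i*
   improper (fun x => sin (x * xi) * f x)%R)%C.

Definition psi (alpha theta xi : RR) : RR[i] :=
  (`|xi| `^ alpha)%:C%C * cexp (0 +i* (Num.sg xi * theta * pi / 2))%C.

(* [is_RieszFeller alpha theta f g] reads: g = D^{alpha,theta} f.  The Fourier
   condition determines g only almost everywhere; continuity selects the
   representative, so that g is unique and its pointwise values make sense. *)
Definition is_RieszFeller (alpha theta : RR) (f g : RR -> RR) : Prop :=
  [/\ continuous g, Lc g &
      forall xi, fourier g xi = - psi alpha theta xi * fourier f xi].

Fixpoint is_RieszFeller_iter (alpha theta : RR) (n : nat) (f g : RR -> RR)
    : Prop :=
  if n is m.+1 then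
    exists2 h, is_RieszFeller_iter alpha theta m f h &
               is_RieszFeller alpha theta h g
  else g = f.

(* [is_shift alpha theta c f h] reads: f is in the domain of O_c and
   h = O_c f. *)
Definition is_shift (alpha theta c : RR) (f h : RR -> RR) : Prop :=
  Lc f /\
  exists2 g : nat -> RR -> RR,
    forall n, is_RieszFeller_iter alpha theta n f (g n) &
    {uniform, (fun n x => \sum_(0 <= k < n) c ^+ k / k`!%:R * g k x : RR)
       @ \oo --> h}.

(* Derivative of v at t relative to the half-line [0, +oo[; it is the
   right derivative when t = 0. *)
Definition is_time_derivative (v : RR -> RR) (t l : RR) : Prop :=
  (v (t + h) - v t) / h @[h --> within [set h | 0 <= t + h] (0 : RR)^'] --> l.

(* Since a D - lambda (I - O_1) has Fourier symbol
   - a psi - lambda (1 - exp (- psi)), i.e. the derivative at t = 0 of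
   exp (- a t psi - lambda t (1 - exp (- psi))), the jump part comes with the
   sign - lambda (I - O_1). *)
Definition solves_ivp (alpha theta a lambda : RR) (f : RR -> RR)
    (u : RR -> RR -> RR) : Prop :=
  (forall x, u x 0 = f x) /\
  forall t, 0 <= t ->
    exists Du Ou : RR -> RR,
      [/\ is_RieszFeller alpha theta (u ^~ t) Du,
          is_shift alpha theta 1 (u ^~ t) Ou &
          forall x, is_time_derivative (u x) t
                      (a * Du x - lambda * (u x t - Ou x))].

Section processes.
Context {d : measure_display} {T : measurableType d}.
Variable P : probability T RR.

Definition increment (X : RR -> T -> RR) (s t : RR) : T -> RR :=
  fun w => X t w - X s w.

Definition independent_increments (X : RR -> T -> RR) : Prop :=
  forall (n : nat) (t : nat -> RR) (A : nat -> set RR),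
    0 <= t 0%N -> (forall i, t i <= t i.+1) -> (forall i, measurable (A i)) ->
    P (\bigcap_(i in `I_n) increment X (t i) (t i.+1) @^-1` A i) =
    (\prod_(i < n) P (increment X (t i) (t i.+1) @^-1` A i))%E.

Definition stationary_increments (X : RR -> T -> RR) : Prop :=
  forall (s t : RR) (A : set RR), 0 <= s -> s <= t -> measurable A ->
    P (increment X s t @^-1` A) = P (X (t - s) @^-1` A).

Definition stochastically_continuous (X : RR -> T -> RR) : Prop :=
  forall s eps : RR, 0 <= s -> 0 < eps ->
    P [set w | eps < `|increment X s t w| ]
      @[t --> within [set t | 0 <= t] (nbhs s)] --> 0%E.

Definition levy_process (X : RR -> {RV P >-> RR}) : Prop :=
  [/\ {ae P, forall w, X 0 w = 0}, independent_increments X,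
      stationary_increments X & stochastically_continuous X].

Definition charfun (X : T -> RR) (xi : RR) : RR[i] :=
  (fine 'E_P[fun w => cos (xi * X w)] +i*
   fine 'E_P[fun w => sin (xi * X w)])%C.

Definition stable_process (alpha theta : RR) (X : RR -> {RV P >-> RR}) : Prop :=
  levy_process X /\
  forall t xi, 0 <= t ->
    charfun (X t) xi = cexp (- (t%:C%C * psi alpha theta xi)).

(* The increments are written additively because subtraction on nat is
   truncated. *)
Definition poisson_process (lambda : RR) (N : RR -> {RV P >-> nat}) : Prop :=
  [/\ {ae P, forall w, N 0 w = 0%N},
      independent_increments (fun t w => (N t w)%:R) &
      forall s t k, 0 <= s -> s <= t ->
        P [set w | N t w = (N s w + k)%N] =
        (expR (- (lambda * (t - s))) * (lambda * (t - s)) ^+ k / k`!%:R)%:E].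

Definition history d' (E : measurableType d') (X : RR -> T -> E)
    : set (set T) :=
  <<s [set B | exists t A, [/\ 0 <= t, measurable A & B = X t @^-1` A] ] >>.

Definition independent_processes d1 d2 (E1 : measurableType d1)
    (E2 : measurableType d2) (X : RR -> T -> E1) (Y : RR -> T -> E2) : Prop :=
  forall A B, history X A -> history Y B -> P (A `&` B) = (P A * P B)%E.

(* No such p exists when alpha = 1 and |theta| = 1: then psi is +i xi or -i xi
   and the process is a deterministic drift. *)
Definition transition_density (X : RR -> {RV P >-> RR}) (p : RR -> RR -> RR)
    : Prop :=
  forall s, 0 < s ->
    [/\ measurable_fun setT (p ^~ s), forall y, 0 <= p y s &
        forall A, measurable A ->
          distribution P (X s) A = (\int[lebesgue_measure]_(y in A) (p y s)%:E)%E].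

End processes.

(* The integral of h (y) p (y, s) dy, with p (., 0) the Dirac mass at 0. *)
Definition density_integral (p : RR -> RR -> RR) (h : RR -> RR) (s : RR) : RR :=
  if s == 0 then h 0 else \int[lebesgue_measure]_y (h y * p y s).

(* Main.v *)
Require Import Defs.
From HB Require Import structures.
From mathcomp Require Import all_boot all_order all_algebra.
From mathcomp Require Import all_classical all_reals all_analysis.
From mathcomp Require Import complex Rstruct Rstruct_topology.
From mathcomp Require Import measurable_realfun measurable_fun_approximation.
From mathcomp Require Import simple_functions exp trigo ring lra.
From Coquelicot Require Coquelicot.

Set Implicit Arguments.
Unset Strict Implicit.
Unset Printing Implicit Defensive.

Import Order.TTheory GRing.Theory Num.Theory numFieldNormedType.Exports.

Local Open Scope classical_set_scope.
Local Open Scope ring_scope.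

(** Everything is diagonal on the Fourier side.  Write psi for the symbol of the
    stable process and F for the Fourier transform of f.

    Integrability of all the iterates of the Riesz-Feller derivative D makes
    every psi^k F bounded, hence (multiplying by a further large power of psi)
    every psi^k F integrable [cintegrable_Fhat].  By Fourier inversion
    [ft_inversion], every iterate D^k f is therefore the inverse transform of
    (-psi)^k F at every point, because it is continuous; in particular it is
    bounded [iterD_bounded].  For a random variable X, the average
    E g(x - X) multiplies transforms by the characteristic function of X,
    whether g is given by its own transform [ft_avg] or as an inverse transform
    [avg_inv_ft]; so averaging commutes with D [RieszFeller_avg].

    Conditioning on the Poisson count gives the series for the transition
    semigroup [cvg_subordinated_mean] and, summed with the exponential series
    [cexp_series], the characteristic function exp (t m) of Z(t), where
    m = - a psi + lambda (exp (- psi) - 1) [charfun_subordinated].  Thus u(x, t)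
    is the inverse transform of exp (t m) F, and as Re m <= 0 it may be
    differentiated in t under the integral, with a remainder quadratic in the
    time increment [inv_ft_cexp_taylor2]: its time derivative is the inverse
    transform of m exp (t m) F.

    It remains to recognise the operator with symbol exp (- psi).  The series
    that defines O_1 f cannot be summed on the Fourier side, since exp |psi| F
    need not be integrable.  Instead T_s f (x) = E f(x - S(s)) has k-th
    derivative T_s D^k f in s, and T_s is a contraction for the supremum norm,
    so that Taylor's formula at s = 0 bounds the difference between T_1 f and
    the n-th partial sum by sup |D^n f| / n! [stable_taylor].  This bound tends
    to 0 because the series converges uniformly, whence O_1 f = T_1 f
    [shift_is_stable_mean].  Averaging the uniformly convergent series for f
    over Z(t) then gives that of O_1 u(., t). *)

(** * Lebesgue integrals of real-valued functions *)

Local Notation "mu .-L1 f" := (mu.-integrable setT (EFin \o f))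
  (at level 2, format "mu .-L1  f", f at level 9).

Section Rintegral_facts.
Context d (T : measurableType d) (R : realType).
Variable mu : {measure set T -> \bar R}.
Implicit Types f g : T -> R.

Lemma L1_measurable f : mu.-L1 f -> measurable_fun setT f.
Proof. by move=> /measurable_int/measurable_EFinP. Qed.

Lemma le_L1 g f : mu.-L1 g -> measurable_fun setT f ->
  (forall x, `|f x| <= g x) -> mu.-L1 f.
Proof.
move=> + mf fg; apply: le_integrable => //; first exact/measurable_EFinP.
by move=> x _ /=; rewrite lee_fin (le_trans (fg x))// ler_norm.
Qed.

Lemma L1D f g : mu.-L1 f -> mu.-L1 g -> mu.-L1 (fun x => f x + g x).
Proof. by move=> fi gi; have := integrableD measurableT fi gi. Qed.

Lemma L1B f g : mu.-L1 f -> mu.-L1 g -> mu.-L1 (fun x => f x - g x).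
Proof. by move=> fi gi; have := integrableB measurableT fi gi. Qed.

Lemma L1Z c f : mu.-L1 f -> mu.-L1 (fun x => c * f x).
Proof. by move=> fi; have := integrableZl measurableT c fi. Qed.

Lemma L1_norm f : mu.-L1 f -> mu.-L1 (fun x => `|f x|).
Proof. exact: integrable_norm. Qed.

Lemma le_norm_Rintegral g f : mu.-L1 g -> measurable_fun setT f ->
  (forall x, `|f x| <= g x) -> `|\int[mu]_x f x| <= \int[mu]_x g x.
Proof.
move=> gi mf fg; have fi := le_L1 gi mf fg.
rewrite (le_trans (le_normr_Rintegral measurableT fi))//.
by apply: le_Rintegral => //; exact: L1_norm.
Qed.

Lemma EFin_Rintegral f : mu.-L1 f ->
  (\int[mu]_x f x)%:E = (\int[mu]_x (f x)%:E)%E.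
Proof. by move=> fi; rewrite fineK//; exact: integrable_fin_num. Qed.

Lemma Rintegral_sum n (f : nat -> T -> R) : (forall k, mu.-L1 (f k)) ->
  mu.-L1 (fun x => \sum_(0 <= k < n) f k x) /\
  \int[mu]_x (\sum_(0 <= k < n) f k x) = \sum_(0 <= k < n) \int[mu]_x f k x.
Proof.
move=> fi; elim: n => [|n [IHi IHe]].
  rewrite big_nil (_ : (fun _ => _) = cst 0); last first.
    by apply/funext => x; rewrite big_nil.
  by split; [exact: integrable0|rewrite /Rintegral integral0].
rewrite big_nat_recr//= (_ : (fun _ => _) =
    fun x => \sum_(0 <= k < n) f k x + f n x); last first.
  by apply/funext => x; rewrite big_nat_recr.
by split; [exact: L1D|rewrite RintegralD// IHe].
Qed.

Lemma dominated_cvg_R (f_ : nat -> T -> R) f g :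
  (forall n, measurable_fun setT (f_ n)) ->
  (forall x, f_ ^~ x @ \oo --> f x) -> mu.-L1 g ->
  (forall n x, `|f_ n x| <= g x) ->
  \int[mu]_x f_ n x @[n --> \oo] --> \int[mu]_x f x.
Proof.
move=> mf_ cf gi fg.
have mf : measurable_fun setT f.
  by apply: (measurable_fun_cvg mf_) => x _; exact: cf.
have fi : mu.-L1 f.
  apply: (le_L1 gi mf) => x.
  apply: (cvgr_to_le (cvg_norm (cf x))).
  by near=> n; exact: fg.
apply: fine_cvg; rewrite fineK; last exact: integrable_fin_num.
apply: (dominated_cvg measurableT (f_ := fun n => EFin \o f_ n) (g := EFin \o g)) => //.
- by move=> n; exact/measurable_EFinP.
- by move=> x _; apply: cvg_EFin; [exact: nearW|exact: cf].
- by move=> n x _; rewrite lee_fin.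
Unshelve. all: by end_near. Qed.

End Rintegral_facts.

Section prob.
Context d (T : measurableType d) (R : realType) (P : probability T R).

Lemma L1_bounded (f : T -> R) M : measurable_fun setT f ->
  (forall x, `|f x| <= M) -> P.-L1 f.
Proof.
move=> mf fM; apply: (@le_L1 _ _ _ _ (cst M)) => //.
exact: finite_measure_integrable_cst.
Qed.

Lemma Rintegral_prob_cst (c : R) : \int[P]_x c = c.
Proof. by rewrite Rintegral_cst// [X in fine X](probability_setT P) mulr1. Qed.

Lemma le_Rintegral_prob (f : T -> R) M : measurable_fun setT f ->
  (forall x, `|f x| <= M) -> `|\int[P]_x f x| <= M.
Proof.
move=> mf fM; rewrite -[leRHS](Rintegral_prob_cst M).
by apply: le_norm_Rintegral => //; exact: finite_measure_integrable_cst.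
Qed.
End prob.

Section RFubini.
Context d1 d2 (T1 : measurableType d1) (T2 : measurableType d2) (R : realType).
Variables (m1 : {sigma_finite_measure set T1 -> \bar R})
  (m2 : {sigma_finite_measure set T2 -> \bar R}).

(** Fubini's theorem for real-valued integrals.  Integrability of every section,
    and not of almost every one, makes the inner real-valued integrals agree
    with the extended ones everywhere. *)
Lemma RFubini (f : T1 -> T2 -> R) (h : T1 -> R) :
  measurable_fun setT (fun z => f z.1 z.2) ->
  (forall x, m2.-L1 (f x)) -> (forall y, m1.-L1 (f ^~ y)) ->
  (forall x, \int[m2]_y `|f x y| <= h x) -> m1.-L1 h ->
  [/\ m1.-L1 (fun x => \int[m2]_y f x y), m2.-L1 (fun y => \int[m1]_x f x y) &
    \int[m1]_x \int[m2]_y f x y = \int[m2]_y \int[m1]_x f x y].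
Proof.
move=> mf f1 f2 fh hi.
pose F z := (f z.1 z.2)%:E.
have mF : measurable_fun setT F by exact/measurable_EFinP.
have Fi : (m1 \x m2)%E.-integrable setT F.
  apply/integrable12ltyP => //=.
  apply: (@le_lt_trans _ _ (\int[m1]_x `|(h x)%:E|)%E); last first.
    by case/integrableP: hi.
  apply: ge0_le_integral => //.
  - by move=> x _; exact: integral_ge0.
  - apply: (measurable_fun_fubini_tonelli_F (abse \o F)) => //=.
    exact: measurableT_comp.
  - apply: measurableT_comp => //; exact: (measurable_int m1).
  - move=> x _; rewrite /F/=.
    have /= := EFin_Rintegral (L1_norm (f1 x)) => <-.
    by rewrite lee_fin (le_trans (fh x))// ler_norm.
have E1 x : fubini_F m2 F x = (\int[m2]_y f x y)%:E.
  by rewrite EFin_Rintegral.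
have E2 y : fubini_G m1 F y = (\int[m1]_x f x y)%:E.
  by rewrite EFin_Rintegral.
have I1 : m1.-L1 (fun x => \int[m2]_y f x y).
  have := integrable_fubini_F Fi; apply: eq_integrable => // x _; exact: E1.
have I2 : m2.-L1 (fun y => \int[m1]_x f x y).
  apply/integrableP; split.
    apply: eq_measurable_fun (measurable_fubini_G Fi) => y _; exact: E2.
  apply: le_lt_trans ((integrable21ltyP m1 m2 mF).1 Fi).
  apply: ge0_le_integral => //.
  - apply: measurableT_comp => //.
    apply: eq_measurable_fun (measurable_fubini_G Fi) => y _; exact: E2.
  - apply: (measurable_fun_fubini_tonelli_G (abse \o F)) => //=.
    exact: measurableT_comp.
  - move=> y _; rewrite [X in `|X|%E](_ : _ = fubini_G m1 F y) ?E2//.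
    by rewrite -E2; apply: le_abse_integral => //; exact: measurableT_comp.
split => //.
have := Fubini Fi => E.
rewrite /Rintegral; congr fine.
transitivity (\int[m1]_x \int[m2]_y F (x, y))%E.
  by apply: eq_integral => x _; exact/esym/E1.
by rewrite E; apply: eq_integral => y _; exact: E2.
Qed.

End RFubini.

(** * Translations and the mean value theorem *)

Section translation.
Context {R : realType}.
Notation mu := (@lebesgue_measure R).

Lemma continuous_normf (f : R -> R) : continuous f ->
  continuous (fun x => `|f x|).
Proof.
by move=> cf x; apply: continuous_comp; [exact: cf|exact: norm_continuous].
Qed.

Lemma ge0_integral_translate (f : R -> R) z : continuous f ->
  (forall x, 0 <= f x) ->
  (\int[mu]_x (f (x - z))%:E = \int[mu]_x (f x)%:E)%E.
Proof.
move=> cf f0.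
have dF x : is_derive (x : R) (1 : R) (fun y : R => y - z) 1.
  by apply: is_derive_eq; rewrite subr0.
have dE : derive1 (fun y : R => y - z) = cst 1.
  by apply/funext => x; rewrite derive1E; exact: derive_val.
rewrite [RHS](@increasing_ge0_integration_by_substitutionT _ (fun y => y - z))//.
- by apply: eq_integral => x _; rewrite dE /= mulr1.
- by move=> x y xy; rewrite ltrD2r.
- by rewrite dE; exact: cst_continuous.
- by rewrite dE; exact: is_cvg_cst.
- by rewrite dE; exact: is_cvg_cst.
- exact: cvg_addrr_Ny.
- exact: cvg_addrr.
Qed.

Lemma L1_translate (f : R -> R) z : continuous f -> mu.-L1 f ->
  mu.-L1 (fun x => f (x - z)).
Proof.
move=> cf fi; apply/integrableP; split.
  apply/measurable_EFinP; apply: continuous_measurable_fun => x.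
  apply: (@continuous_comp _ _ _ (fun x => x - z) f); last exact: cf.
  by apply: cvgB; [exact: cvg_id|exact: cvg_cst].
under eq_integral do rewrite /=.
rewrite (ge0_integral_translate z (f := fun x => `|f x|))//.
  by case/integrableP: fi.
move=> x; apply: (@continuous_comp _ _ _ f); first exact: cf.
exact: norm_continuous.
Qed.

Lemma Rintegral_translate (f : R -> R) z : continuous f -> mu.-L1 f ->
  \int[mu]_x f (x - z) = \int[mu]_x f x.
Proof.
move=> cf fi.
have cn := continuous_normf cf.
have cs z' : continuous (fun x => f (x - z')).
  move=> x; apply: (@continuous_comp _ _ _ (fun x => x - z') f); last exact: cf.
  by apply: cvgB; [exact: cvg_id|exact: cvg_cst].
(* f = |f| - (|f| - f), a difference of two nonnegative continuous functions *)
have E g : mu.-L1 g ->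
    \int[mu]_x g x = \int[mu]_x `|g x| - \int[mu]_x (`|g x| - g x).
  move=> gi; rewrite -RintegralB//; first by apply: eq_Rintegral => x _; ring.
  - exact: L1_norm.
  - by apply: L1B => //; exact: L1_norm.
have iz := L1_translate z cf fi.
rewrite (E _ fi) (E _ iz) /Rintegral (ge0_integral_translate z (f := fun x => `|f x|))//.
rewrite (ge0_integral_translate z (f := fun x => `|f x| - f x))//.
  by move=> x; apply: cvgB; [exact: cn|exact: cf].
by move=> x; rewrite subr_ge0 ler_norm.
Qed.

End translation.

Section measurable_trigo.
Context {R : realType}.

Lemma measurable_cos : measurable_fun [set: R] (@cos R).
Proof. by apply: continuous_measurable_fun; exact: continuous_cos. Qed.

Lemma measurable_sin : measurable_fun [set: R] (@sin R).
Proof. by apply: continuous_measurable_fun; exact: continuous_sin. Qed.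

End measurable_trigo.

Section mvt.
Context {R : realType}.
Implicit Types f g : R -> R.

Lemma is_derive_continuous f df :
  (forall x : R, is_derive (x : R) (1 : R) f (df x)) -> continuous f.
Proof.
move=> fd x; apply: differentiable_continuous; apply/derivable1_diffP.
by case: (fd x).
Qed.

Lemma mvt_bound f df (a b M : R) : a <= b ->
  (forall x, a <= x <= b -> is_derive (x : R) (1 : R) f (df x)) ->
  (forall x, a <= x <= b -> `|df x| <= M) ->
  `|f b - f a| <= M * (b - a).
Proof.
move=> ab fd fM.
have [x xab| |c + ->] := @MVT_segment _ f df a b ab.
- by apply: fd; move: xab; rewrite in_itv/= => /andP[/ltW-> /ltW->].
- apply: derivable_within_continuous => x; rewrite in_itv/= => xab.
  by have [] := fd x xab.
rewrite in_itv/= => cab; rewrite normrM (ger0_norm (x := b - a)) ?subr_ge0//.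
by rewrite ler_wpM2r ?subr_ge0// fM.
Qed.

(** Two applications of the mean value theorem: the first bounds the increments
    of [f1], the second those of [f x - (x - s) * f1 s]. *)
Lemma taylor2_bound f f1 f2 (M b s s' : R) : 0 <= s <= b -> 0 <= s' <= b ->
  (forall x, is_derive (x : R) (1 : R) f (f1 x)) ->
  (forall x, is_derive (x : R) (1 : R) f1 (f2 x)) ->
  (forall x, 0 <= x <= b -> `|f2 x| <= M) ->
  `|f s' - f s - (s' - s) * f1 s| <= M * (s' - s) ^+ 2.
Proof.
move=> s0 s'0 d1 d2 fM.
have M0 : 0 <= M := le_trans (normr_ge0 _) (fM s s0).
have step (u v : R) : 0 <= u <= b -> 0 <= v <= b -> `|f1 v - f1 u| <= M * `|v - u|.
  move=> u0 v0; wlog uv : u v u0 v0 / u <= v.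
    move=> H; have [uv|/ltW vu] := leP u v; first exact: H.
    by rewrite distrC (distrC v) H.
  rewrite (ger0_norm (x := v - u)) ?subr_ge0//.
  apply: (mvt_bound uv (df := f2)) => // x /andP[ux xv].
  case/andP: u0 v0 => u0 _ /andP[_ vb].
  by apply: fM; rewrite (le_trans u0)//= (le_trans xv).
pose g x := f x - (x - s) * f1 s.
have dg x : is_derive x (1 : R) g (f1 x - f1 s).
  rewrite /g; apply: is_derive_eq; rewrite !subr0.
  by rewrite scaler0 add0r /GRing.scale/= mulr1.
have gE : f s' - f s - (s' - s) * f1 s = g s' - g s by rewrite /g; ring.
rewrite gE expr2 mulrA.
case/andP: (s0) (s'0) => s_ge0 sb /andP[s'_ge0 s'b].
have [ss'|/ltW s's] := leP s s'.
  apply: (mvt_bound ss' (df := fun x => f1 x - f1 s)) => // x /andP[sx xs'].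
  rewrite (le_trans (step _ _ s0 _))// ?(le_trans s_ge0 sx) ?(le_trans xs')//.
  by rewrite ger0_norm ?subr_ge0// ler_wpM2l// lerD2r.
rewrite distrC (_ : M * (s' - s) * (s' - s) = M * (s - s') * (s - s')); last by ring.
apply: (mvt_bound s's (df := fun x => f1 x - f1 s)) => // x /andP[sx xs'].
rewrite (le_trans (step _ _ s0 _))// ?(le_trans s'_ge0 sx) ?(le_trans xs')//.
by rewrite distrC ger0_norm ?subr_ge0// ler_wpM2l// lerD2l lerN2.
Qed.

End mvt.

(** * Taylor's formula with one-sided derivatives *)

Section taylor_sup.
Context {R : realType}.
Implicit Types (F : nat -> R -> R) (f : R -> R).

(** A uniform quadratic error makes [f'] the derivative of [f] on [0, b],
    one-sided at the end points.  Integration preserves such an estimate, so it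
    replaces differentiation under the integral sign. *)
Definition quadratic_derivative (b : R) (f f' : R -> R) := exists C, forall s s',
  0 <= s <= b -> 0 <= s' <= b -> `|f s' - f s - (s' - s) * f' s| <= C * (s' - s) ^+ 2.

Lemma quadratic_derivative_cvg b (f f' : R -> R) (s : R) :
  quadratic_derivative b f f' -> 0 <= s < b ->
  (f (s + h) - f s) / h @[h --> within [set h | 0 <= s + h] (0 : R)^'] --> f' s.
Proof.
move=> [C H] /andP[s0 sb].
apply/cvgrPdist_le => e e0.
pose K := `|C| + 1; have K0 : 0 < K by rewrite ltr_wpDl.
rewrite near_withinE; near=> h => sh.
have h0 : h != 0 by near: h; exact: nbhs_dnbhs_neq.
have he : `|h| <= e / K.
  near: h; apply: dnbhs0_le; by rewrite divr_gt0.
have hb : s + h <= b.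
  rewrite -lerBrDl (le_trans (ler_norm _))//.
  by near: h; apply: dnbhs0_le; rewrite subr_gt0.
have := H s (s + h); rewrite s0 (ltW sb) sh hb => /(_ isT isT).
rewrite (_ : s + h - s = h); last by ring.
move=> Hs.
rewrite distrC (_ : (f (s + h) - f s) / h - f' s = (f (s + h) - f s - h * f' s) / h); last first.
  by field.
rewrite normrM normfV ler_pdivrMr ?normr_gt0//.
rewrite (le_trans Hs)// -(real_normK (num_real h)) expr2 mulrA ler_wpM2r//.
rewrite (@le_trans _ _ (K * `|h|))// ?ler_wpM2r//.
  by rewrite (le_trans (ler_norm _))// lerDl.
by rewrite mulrC -ler_pdivlMr.
Unshelve. all: by end_near. Qed.

Lemma quadratic_derivative_is_derive b (f f' : R -> R) (s : R) :
  quadratic_derivative b f f' -> 0 < s < b -> is_derive (s : R) (1 : R) f (f' s).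
Proof.
move=> [C H] /andP[s0 sb].
have cv : h^-1 *: (f (h *: (1 : R) + s) - f s) @[h --> (0 : R)^'] --> (f' s : R).
  have s0b : 0 <= s < b by rewrite ltW.
  have := quadratic_derivative_cvg (ex_intro _ C H) s0b.
  move=> /cvgrPdist_le cv; apply/cvgrPdist_le => e e0.
  have := cv e e0; rewrite near_withinE => {}cv.
  near=> h.
  have sh : 0 <= s + h.
    have : `|h| <= s by near: h; exact: dnbhs0_le.
    by rewrite ler_norml -lerBlDl sub0r => /andP[].
  have -> : h^-1 *: (f (h *: (1 : R) + s) - f s) = (f (s + h) - f s) / h.
    by rewrite /GRing.scale/= mulr1 mulrC (addrC h).
  by move: sh; near: h.
apply: DeriveDef; first by apply/cvg_ex; exists (f' s).
exact/cvg_lim.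
Unshelve. all: by end_near. Qed.

Lemma quadratic_derivative_continuous b (f f' : R -> R) :
  quadratic_derivative b f f' -> {within `[0, b], continuous f}.
Proof.
move=> [C H]; apply/subspace_continuousP => s /=; rewrite in_itv/= => s0.
apply/cvgrPdist_le => e e0; rewrite near_withinE.
pose K := `|f' s| + `|C| + 1.
have K0 : 0 < K by rewrite ltr_wpDl// addr_ge0.
have near_s (r : R) : 0 < r -> \forall t \near s, `|t - s| <= r.
  by move=> r0; apply: (@cvgr_distC_le _ _ _ (nbhs s) _ id s) => //; exact: cvg_id.
near=> t => /=; rewrite in_itv/= => t0.
have te : `|t - s| <= e / K.
  by near: t; apply: near_s; rewrite divr_gt0.
have t1 : `|t - s| <= 1.
  by near: t; exact: near_s.
have Hs := H s t s0 t0.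
rewrite distrC (_ : f t - f s = (f t - f s - (t - s) * f' s) + (t - s) * f' s); last by ring.
rewrite (le_trans (ler_normD _ _))//.
apply: (@le_trans _ _ (K * `|t - s|)); last by rewrite mulrC -ler_pdivlMr.
rewrite (_ : K * _ = (`|C| + 1) * `|t - s| + `|f' s| * `|t - s|); last first.
  by rewrite /K; ring.
rewrite lerD//; last by rewrite normrM mulrC.
rewrite (le_trans Hs)// -(real_normK (num_real (t - s))).
apply: (@le_trans _ _ (`|C| * `|t - s|)).
  rewrite (@le_trans _ _ (`|C| * `|t - s| ^+ 2))//.
    by rewrite ler_wpM2r ?sqr_ge0// ler_norm.
  by rewrite ler_wpM2l// expr2 ler_piMl.
by rewrite ler_wpM2r// lerDl.
Unshelve. all: by end_near. Qed.

Lemma ler0_bound_of_derive b (f f' B B' : R -> R) (s : R) :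
  quadratic_derivative b f f' -> f 0 = 0 -> B 0 = 0 ->
  (forall x, is_derive (x : R) (1 : R) B (B' x)) ->
  (forall x, 0 <= x <= b -> f' x <= B' x) -> 0 <= s <= b -> f s <= B s.
Proof.
move=> fd f0 b0 Bd fB /andP[s0 sb].
have [c cs] : exists2 c, c \in `[0, s]%R & (B s - f s) - (B 0 - f 0) = (B' c - f' c) * (s - 0).
  apply: (@MVT_segment _ (fun x => B x - f x) (fun x => B' x - f' x)) => //.
    move=> x; rewrite in_itv/= => /andP[x0 xs].
    have x0b : 0 < x < b by rewrite x0 (lt_le_trans xs).
    have := quadratic_derivative_is_derive fd x0b; have := Bd x.
    by move=> ? ?; exact: is_deriveB.
  have cB : {within `[0, s], continuous B}.
    by apply: continuous_subspaceT; exact: is_derive_continuous Bd.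
  have cf : {within `[0, s], continuous f}.
    apply: continuous_subspaceW (quadratic_derivative_continuous fd).
    by apply: subset_itvl; rewrite bnd_simp.
  by move=> x; apply: cvgB; [exact: cB|exact: cf].
rewrite f0 b0 !subr0 -subr_ge0 => ->; rewrite mulr_ge0// subr_ge0 fB//.
by move: cs; rewrite in_itv/= => /andP[-> /le_trans->].
Qed.

(** Taylor's formula at 0 for a function whose successive derivatives are the
    [F k], with only right derivatives at 0.  By induction the derivative of the
    remainder is at most [M * x ^+ n / n`!]; comparing the remainder with the
    primitive of this bound concludes. *)
Lemma taylor_sup b n F (M s : R) :
  (forall k, quadratic_derivative b (F k) (F k.+1)) ->
  (forall s, 0 <= s <= b -> `|F n s| <= M) -> 0 <= s <= b ->
  `|F 0%N s - \sum_(0 <= k < n) s ^+ k / k`!%:R * F k 0| <= M * s ^+ n / n`!%:R.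
Proof.
elim: n F s => [|n IH] F s FD FM s0.
  by rewrite big_nil subr0 expr0 mulr1 divr1 FM.
have pS x : \sum_(0 <= k < n.+1) x ^+ k / k`!%:R * F k 0 =
    F 0%N 0 + \sum_(0 <= k < n) x ^+ k.+1 / k.+1`!%:R * F k.+1 0.
  by rewrite big_nat_recl// expr0 fact0 divr1 mul1r.
pose p x : R := \sum_(0 <= k < n) x ^+ k.+1 / k.+1`!%:R * F k.+1 0.
pose p' x : R := \sum_(0 <= k < n) x ^+ k / k`!%:R * F k.+1 0.
have factS (k : nat) : (k.+1)`!%:R = k.+1%:R * k`!%:R :> R by rewrite factS natrM.
have fact0 (k : nat) : k`!%:R != 0 :> R by rewrite pnatr_eq0 -lt0n fact_gt0.
have monoE (k : nat) (c x : R) : is_derive (x : R) (1 : R)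
    (fun x => x ^+ k.+1 / k.+1`!%:R * c) (x ^+ k / k`!%:R * c).
  have H (r : R) : is_derive (x : R) (1 : R) (fun x => r * x ^+ k.+1)
      (r * (k.+1%:R * x ^+ k)).
    have X : is_derive (x : R) (1 : R) ((@id R) ^+ k.+1) (k.+1%:R * x ^+ k).
      by apply: is_derive_eq; rewrite /GRing.scale/= mulr1.
    have -> : (fun x => r * x ^+ k.+1) = r *: ((@id R) ^+ k.+1).
      by rewrite exprfctE.
    exact: is_deriveZ.
  rewrite (_ : (fun _ => _) = (fun x => (k.+1`!%:R^-1 * c) * x ^+ k.+1)); last first.
    by apply/funext => y; ring.
  rewrite (_ : _ * c = (k.+1`!%:R^-1 * c) * (k.+1%:R * x ^+ k))//.
  by rewrite factS; field; rewrite fact0 nat1r pnatr_eq0.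
have dp x : is_derive (x : R) (1 : R) p (p' x).
  rewrite /p /p'; elim: n {IH FM pS p p'} => [|k IHk].
    rewrite big_nil (_ : (fun _ => _) = cst 0); first exact: is_derive_cst.
    by apply/funext => y; rewrite big_nil.
  rewrite big_nat_recr//= (_ : (fun _ => _) = (fun y =>
    \sum_(0 <= i < k) y ^+ i.+1 / i.+1`!%:R * F i.+1 0 +
    y ^+ k.+1 / k.+1`!%:R * F k.+1 0)).
    exact: is_deriveD.
  by apply/funext => y; rewrite big_nat_recr.
pose g x := F 0%N x - F 0%N 0 - p x.
have gd : forall x, 0 <= x <= b -> `|F 1%N x - p' x| <= M * x ^+ n / n`!%:R.
  by move=> x x0; apply: (IH (fun k => F k.+1)).
have {}gd x : 0 <= x <= b -> - (M * x ^+ n / n`!%:R) <= F 1%N x - p' x <= M * x ^+ n / n`!%:R.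
  by move=> /gd; rewrite ler_norml.
have -> : F 0%N s - \sum_(0 <= k < n.+1) s ^+ k / k`!%:R * F k 0 = F 0%N s - F 0%N 0 - p s.
  by rewrite pS opprD addrA.
have p0 : p 0 = 0.
  by rewrite /p big1_seq// => k _; rewrite expr0n/= !mul0r.
pose B x := M * x ^+ n.+1 / n.+1`!%:R; pose B' x := M * x ^+ n / n`!%:R.
have db x : is_derive (x : R) (1 : R) B (B' x).
  have := monoE n M x; congr (is_derive _ _ _ _); last by rewrite /B'; ring.
  by apply/funext => y; rewrite /B; ring.
have b0 : B 0 = 0 by rewrite /B expr0n/= mulr0 mul0r.
(* the same comparison applied to [F 0] and to its opposite *)
pose G0 x := F 0%N x - F 0%N 0.
have dG0 : quadratic_derivative b G0 (F 1%N).
  have [C HC] := FD 0%N; exists C => u v u0 v0; rewrite /G0.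
  by rewrite (_ : F 0%N v - _ - _ = F 0%N v - F 0%N u); [exact: HC|ring].
have dG0N : quadratic_derivative b (\- G0) (\- F 1%N).
  have [C HC] := dG0; exists C => u v u0 v0 /=.
  rewrite -normrN (_ : - (- G0 v - - G0 u - (v - u) * - F 1%N u) =
    G0 v - G0 u - (v - u) * F 1%N u); last by ring.
  exact: HC.
rewrite ler_norml -[F 0%N s - _]/(G0 s) -[X in - X]/(B s) -[X in _ && (_ <= X)]/(B s).
have G00 : G0 0 = 0 by rewrite /G0 subrr.
apply/andP; split; last first.
  rewrite lerBlDr; apply: (ler0_bound_of_derive (B := fun x => B x + p x)
    (B' := fun x => B' x + p' x) dG0) => //.
  - by rewrite b0 p0 addr0.
  - by move=> x x0; rewrite -lerBlDr; case/andP: (gd x x0).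
suff : - G0 s <= B s - p s by lra.
apply: (ler0_bound_of_derive (f := \- G0) (B := fun x => B x - p x)
    (B' := fun x => B' x - p' x) dG0N) => //.
- by rewrite /= G00 oppr0.
- by rewrite b0 p0 subr0.
- move=> x x0 /=; case/andP: (gd x x0) => + _.
  by rewrite -[X in - X <= _]/(B' x); lra.
Qed.

End taylor_sup.

(** * Image measures and randomly indexed variables *)

Section weighted_image.
Context d1 d2 (T1 : measurableType d1) (T2 : measurableType d2) (R : realType).
Variables (mu : {measure set T1 -> \bar R}) (nu : {measure set T2 -> \bar R}).
Variables (Y : T1 -> T2) (q : T1 -> R).
Hypothesis mY : measurable_fun setT Y.
Hypothesis mq : measurable_fun setT q.
Hypothesis q0 : forall x, 0 <= q x.
Hypothesis nuE : forall B, measurable B ->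
  nu B = (\int[mu]_(x in Y @^-1` B) (q x)%:E)%E.

Import HBNNSimple.
Local Open Scope ereal_scope.

(** If the measure with density [q] with respect to [mu] has image [nu] under
    [Y], integrals against [nu] are integrals against [mu]: the claim holds for
    indicators, hence for simple functions, hence in the monotone limit. *)
Lemma ge0_integral_weighted (f : T2 -> \bar R) : measurable_fun setT f ->
  (forall y, 0 <= f y) ->
  \int[nu]_y f y = \int[mu]_x (f (Y x) * (q x)%:E).
Proof.
move=> mf f0; pose h := nnsfun_approx measurableT mf.
have mh n : measurable_fun setT (h n) by exact: measurable_funP.
have -> : \int[nu]_y f y = lim (\int[nu]_y (EFin \o h n) y @[n --> \oo]).
  rewrite -monotone_convergence//.
  - apply: eq_integral => y _; apply/esym/cvg_lim => //.
    by apply: cvg_nnsfun_approx => // z _; exact: f0.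
  - by move=> n; exact/measurable_EFinP.
  - by move=> n y _ /=; rewrite lee_fin.
  - by move=> y _ a b ab; rewrite lee_fin; exact/lefP/nd_nnsfun_approx.
have -> : \int[mu]_x (f (Y x) * (q x)%:E) =
    lim (\int[mu]_x ((h n (Y x))%:E * (q x)%:E) @[n --> \oo]).
  rewrite -monotone_convergence//.
  - apply: eq_integral => x _; apply/esym/cvg_lim => //.
    apply: cvgeZr => //; apply: cvg_nnsfun_approx => // z _; exact: f0.
  - move=> n; apply/measurable_EFinP; apply: measurable_funM => //.
    exact: measurableT_comp.
  - by move=> n x _ /=; rewrite mule_ge0 ?lee_fin.
  - move=> x _ a b ab /=; rewrite lee_wpmul2r ?lee_fin//.
    by exact/lefP/nd_nnsfun_approx.
suff E n : \int[nu]_y (EFin \o h n) y = \int[mu]_x ((h n (Y x))%:E * (q x)%:E).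
  by under eq_fun do rewrite E.
transitivity (\int[nu]_y
   (\sum_(r \in range (h n)) (r * \1_(h n @^-1` [set r]) y)%:E)).
  by apply: eq_integral => y _; rewrite /= fimfunE -fsumEFin.
have ind0 (r : R) y : (0 <= r * \1_(h n @^-1` [set r]) y)%R.
  by rewrite -lee_fin EFinM nnfun_muleindic_ge0.
rewrite ge0_integral_fsum//; last 2 first.
- by move=> r; apply/measurable_EFinP; exact: measurable_funM.
- by move=> r y _; rewrite lee_fin.
transitivity (\int[mu]_x (\sum_(r \in range (h n))
    (r * \1_(h n @^-1` [set r]) (Y x))%:E * (q x)%:E)); last first.
  apply: eq_integral => x _.
  rewrite -ge0_mule_fsuml => [|r]; last by rewrite lee_fin.
  by rewrite fsumEFin // -(fimfunE _ (Y x)).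
have mi (r : R) : measurable (h n @^-1` [set r]).
  by rewrite -[X in measurable X]setTI; exact: mh.
have mI (r : R) : measurable_fun setT (fun x => \1_(h n @^-1` [set r]) (Y x) : R).
  exact: (measurableT_comp (@measurable_indic _ T2 R setT _ (mi r)) mY).
rewrite ge0_integral_fsum//; last 2 first.
- move=> r; apply: emeasurable_funM; last exact/measurable_EFinP.
  by apply/measurable_EFinP; exact: measurable_funM.
- by move=> r x _; rewrite mule_ge0 ?lee_fin.
apply: eq_fsbigr => r rhn.
have r0 : (0 <= r)%R by move: rhn; rewrite inE => -[y _ <-].
under eq_integral do rewrite EFinM.
under [RHS]eq_integral do rewrite EFinM -muleA.
rewrite ge0_integralZl ?lee_fin//; last first.
  by apply/measurable_EFinP; exact: measurable_indic.
rewrite ge0_integralZl ?lee_fin//; last 2 first.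
- by apply: emeasurable_funM; exact/measurable_EFinP.
- by move=> y _; rewrite mule_ge0// lee_fin.
congr (_ * _); rewrite integral_indic// setIT nuE//.
rewrite [LHS]integral_mkcond; apply: eq_integral => x _.
rewrite patchE indicE.
have -> : (x \in Y @^-1` (h n @^-1` [set r])) = (Y x \in h n @^-1` [set r]).
  by apply/idP/idP; rewrite !inE.
by case: ifP; rewrite (mul1e, mul0e).
Qed.

End weighted_image.

Section weighted_image_bounded.
Context d1 d2 (T1 : measurableType d1) (T2 : measurableType d2) (R : realType).
Variables (mu : {measure set T1 -> \bar R})
  (nu : {measure set T2 -> \bar R}).
Variables (Y : T1 -> T2) (q : T1 -> R).
Hypothesis nu_fin : (nu setT < +oo)%E.
Hypothesis mY : measurable_fun setT Y.
Hypothesis mq : measurable_fun setT q.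
Hypothesis q0 : forall x, 0 <= q x.
Hypothesis nuE : forall B, measurable B ->
  nu B = (\int[mu]_(x in Y @^-1` B) (q x)%:E)%E.

(** The same for a bounded function, made nonnegative by adding a constant. *)
Lemma Rintegral_weighted (f : T2 -> R) M : measurable_fun setT f ->
  (forall y, `|f y| <= M) ->
  \int[nu]_y f y = \int[mu]_x (f (Y x) * q x).
Proof.
move=> mf fM.
have qi : mu.-L1 q.
  apply/integrableP; split; first exact/measurable_EFinP.
  under eq_integral do rewrite /= ger0_norm//.
  have := nuE measurableT; rewrite preimage_setT => <-.
  exact: nu_fin.
have ci (c : R) : nu.-L1 (fun=> c) by
  apply: (measurable_bounded_integrable measurableT nu_fin) => //; exact: bounded_cst.
have fi : nu.-L1 f by exact: le_L1 (ci M) mf fM.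
have mfY : measurable_fun setT (fun x => f (Y x)) by exact: measurableT_comp.
have fqi : mu.-L1 (fun x => f (Y x) * q x).
  apply: le_L1 (L1Z M qi) _ _; first exact: measurable_funM.
  by move=> x; rewrite normrM (ger0_norm (q0 x)) ler_wpM2r.
have ge0 (g : T2 -> R) : measurable_fun setT g -> (forall y, 0 <= g y) ->
    \int[nu]_y g y = \int[mu]_x (g (Y x) * q x).
  move=> mg g0; rewrite /Rintegral.
  have -> := ge0_integral_weighted mY mq q0 nuE (f := EFin \o g).
  - by [].
  - exact/measurable_EFinP.
  - by move=> y; rewrite lee_fin.
have M0 y : 0 <= f y + M by have := fM y; rewrite ler_norml => /andP[+ _]; rewrite -lerBlDr sub0r.
have e1 := ge0 (fun y => f y + M) (measurable_funD mf (measurable_cst M)) M0.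
have M1 (y : T2) : 0 <= M := le_trans (normr_ge0 _) (fM y).
have e2 := ge0 (fun y => M) (measurable_cst M) M1.
have -> : \int[nu]_y f y = \int[nu]_y (f y + M) - \int[nu]_y M.
  by rewrite RintegralD// addrK.
rewrite e1 e2 -RintegralB//; last 2 first.
- have := L1D fqi (L1Z M qi); apply: eq_integrable => // x _ /=.
  by congr EFin; rewrite mulrDl.
- exact: L1Z.
by apply: eq_Rintegral => x _; ring.
Qed.

End weighted_image_bounded.

Section random_index.
Context d (T : measurableType d) (R : realType) (P : probability T R).

Lemma Rintegral_indep_event (Y : {RV P >-> R}) (A : set T) (f : R -> R) M :
  measurable A ->
  (forall B, measurable B -> P (Y @^-1` B `&` A) = (P (Y @^-1` B) * P A)%E) ->
  measurable_fun setT f -> (forall y, `|f y| <= M) ->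
  \int[P]_w (f (Y w) * \1_A w) = \int[P]_w f (Y w) * fine (P A).
Proof.
move=> mA indep mf fM.
have mY : measurable_fun setT Y by [].
have PAfin : P A \is a fin_num by exact: fin_num_measure.
have PA0 : 0 <= fine (P A) by exact: fine_ge0.
(* the image of the restriction of [P] to [A] under [Y], which by independence
   is a multiple of the law of [Y], has two densities with respect to [P] *)
pose nu := mscale (NngNum PA0) (distribution P Y).
have nuE B : nu B = (P A * P (Y @^-1` B))%E.
  by rewrite /nu/= /mscale/= fineK.
have nu_fin : (nu setT < +oo)%E.
  by rewrite [X in (X < _)%E](nuE setT) preimage_setT probability_setT mule1 ltey_eq PAfin.
have mYB B : measurable B -> measurable (Y @^-1` B).
  by move=> mB; rewrite -[X in measurable X]setTI; exact: mY.
have mfY : measurable_fun setT (fun w => f (Y w)) by exact: measurableT_comp.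
rewrite -RintegralZr//; last first.
  exact: L1_bounded mfY (fun w => fM (Y w)).
rewrite -(Rintegral_weighted (nu := nu) (q := \1_A) nu_fin mY _ _ _ mf fM)//.
- rewrite (Rintegral_weighted (mu := P) (q := cst (fine (P A))) nu_fin mY _ _ _ mf fM)//.
  move=> B mB; rewrite [LHS]nuE -(integral_cst P (mYB B mB)).
  by apply: eq_integral => w _; rewrite /= fineK.
- move=> B mB; rewrite [LHS]nuE integral_indic//; last exact: mYB.
  by rewrite setIC muleC; exact/esym/indep.
Qed.

Variables (Y : nat -> {RV P >-> R}) (K : T -> nat).
Hypothesis mK : forall k, measurable [set w | K w = k].

Lemma measurable_random_index : measurable_fun setT (fun w => Y (K w) w).
Proof.
move=> _ B mB; rewrite setTI.
have -> : (fun w => Y (K w) w) @^-1` B =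
    \bigcup_k ((Y k @^-1` B) `&` [set w | K w = k]).
  apply/seteqP; split => [w /= Bw|w [k _ [/= Bw Kw]]]; first by exists (K w).
  by rewrite /= Kw.
apply: bigcup_measurable => k _; apply: measurableI => //.
by rewrite -[X in measurable X]setTI; exact: measurable_funP.
Qed.

Hypothesis indep : forall k B, measurable B ->
  P (Y k @^-1` B `&` [set w | K w = k]) =
  (P (Y k @^-1` B) * P [set w | K w = k])%E.

(** Cutting off at [K < n] leaves a finite sum over the values of [K], each term
    of which factors by independence; the cut-off is removed by dominated
    convergence. *)
Lemma cvg_Rintegral_random_index (f : R -> R) M :
  measurable_fun setT f -> (forall y, `|f y| <= M) ->
  \sum_(0 <= k < n) \int[P]_w f (Y k w) * fine (P [set w | K w = k])
    @[n --> \oo] --> \int[P]_w f (Y (K w) w).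
Proof.
move=> mf fM.
pose F k w : R := f (Y k w) * \1_[set w | K w = k] w.
have mF k : measurable_fun setT (F k).
  apply: measurable_funM; first exact: measurableT_comp.
  exact: measurable_indic.
have FM k w : `|F k w| <= M.
  rewrite normrM (le_trans _ (fM (Y k w)))// ler_piMr// indicE.
  by case: (_ \in _); rewrite ?normr1 ?normr0.
have Fi k : P.-L1 (F k) by exact: L1_bounded (mF k) (FM k).
have sumE n w : \sum_(0 <= k < n) F k w =
    if (K w < n)%N then f (Y (K w) w) else 0.
  elim: n => [|n IH]; first by rewrite big_nil.
  rewrite big_nat_recr//= IH /F indicE.
  have [<-|Kn] := eqVneq (K w) n.
    by rewrite mem_set// ltnn leqnn add0r mulr1.
  rewrite memNset ?mulr0 ?addr0; last by move=> /= /eqP; exact/negP.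
  by rewrite [in RHS]ltnS [in RHS]leq_eqVlt (negbTE Kn).
have -> : (fun n => \sum_(0 <= k < n) \int[P]_w f (Y k w) * fine (P [set w | K w = k])) =
    (fun n => \int[P]_w (\sum_(0 <= k < n) F k w)).
  apply/funext => n; have [_ ->] := Rintegral_sum n Fi.
  by apply: eq_bigr => k _; rewrite -(Rintegral_indep_event (mK k) (indep k) mf fM).
apply: (@dominated_cvg_R _ _ _ P _ _ (cst M)).
- by move=> n; have [/L1_measurable] := Rintegral_sum n Fi.
- move=> w; apply: cvg_near_cst; near=> n; rewrite sumE.
  by rewrite ifT//; near: n; exact: nbhs_infty_gt.
- exact: finite_measure_integrable_cst.
- move=> n w; rewrite sumE; case: ifP => _; first exact: fM.
  by rewrite normr0 (le_trans _ (fM (Y 0%N w))).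
Unshelve. all: by end_near. Qed.

End random_index.

(** * The Abel and Poisson kernels *)

Section abel_kernel.
Context {R : realType}.
Notation mu := (@lebesgue_measure R).
Variable e : R.
Hypothesis e0 : 0 < e.

Let prim (y t : R) := expR (- e * t) *
  (- e^-1 + (y * sin (y * t) - e * cos (y * t)) / (e ^+ 2 + y ^+ 2)).

Let is_derive_prim y (t : R) :
  is_derive (t : R) (1 : R) (prim y) ((1 + cos (y * t)) * expR (- e * t)).
Proof.
have e2 : e ^+ 2 + y ^+ 2 != 0 by rewrite gt_eqF// ltr_pwDl ?exprn_gt0// sqr_ge0.
rewrite /prim; apply: is_derive_eq.
rewrite /GRing.scale/=.
field.
by rewrite e2 gt_eqF.
Qed.

Let abel_continuous (y : R) :
  continuous (fun x : R => (1 + cos (y * x)) * expR (- e * `|x|)).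
Proof.
move=> x; apply: cvgM.
  apply: cvgD; first exact: cvg_cst.
  apply: (@continuous_comp _ _ _ (fun x : R => y * x)); last exact: continuous_cos.
  exact: mulrl_continuous.
apply: (@continuous_comp _ _ _ (fun x : R => - e * `|x|)); last exact: continuous_expR.
apply: (@continuous_comp _ _ _ (fun x : R => `|x|)); first exact: norm_continuous.
exact: mulrl_continuous.
Qed.

Let prim_cvg (y : R) : prim y x @[x --> +oo] --> (0 : R).
Proof.
set K := (e^-1 + (`|y| + e) / (e ^+ 2 + y ^+ 2)).
have e2 : 0 < e ^+ 2 + y ^+ 2 by rewrite ltr_pwDl ?exprn_gt0// sqr_ge0.
have K0 : 0 <= K.
  apply: addr_ge0; first by rewrite invr_ge0 ltW.
  by apply: divr_ge0; [rewrite addr_ge0// ltW|exact: ltW].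
have fK t : `|- e^-1 + (y * sin (y * t) - e * cos (y * t)) / (e ^+ 2 + y ^+ 2)| <= K.
  rewrite (le_trans (ler_normD _ _))// normrN normfV (gtr0_norm e0) lerD2l.
  rewrite normrM normfV (gtr0_norm e2) ler_pM2r ?invr_gt0//.
  rewrite (le_trans (ler_normB _ _))// !normrM (gtr0_norm e0) lerD//.
  - by rewrite ler_piMr// sin_max.
  - by rewrite ler_piMr ?cos_max// ltW.
apply/cvgrPdist_le => /= eta eta0; near=> t.
have t0 : 0 < t by near: t; exact: nbhs_pinfty_gt.
have et0 : 0 < e * t by exact: mulr_gt0.
rewrite sub0r normrN normrM (gtr0_norm (expR_gt0 _)).
apply: (@le_trans _ _ ((e * t)^-1 * K)).
  rewrite ler_pM ?expR_ge0 ?fK// mulNr expRN lef_pV2 ?posrE ?expR_gt0//.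
  by rewrite (le_trans _ (expR_ge1Dx _))// lerDr.
by rewrite mulrC ler_pdivrMr// mulrA -ler_pdivrMl ?mulr_gt0.
Unshelve. all: by end_near. Qed.

(** Adding 1 to the cosine makes the integrand nonnegative, so that the integral
    over a half-line is the limit of a primitive; [Rintegral_abel] removes the
    constant, which is the case [y = 0]. *)
Lemma integral_exp_cos (y : R) :
  (\int[mu]_x ((1 + cos (y * x)) * expR (- e * `|x|))%:E =
   (2 / e + 2 * e / (e ^+ 2 + y ^+ 2))%:E)%E.
Proof.
rewrite ge0_symfun_integralT; last 3 first.
- by move=> x; rewrite mulr_ge0 ?expR_ge0// -lerBlDl sub0r cos_geN1.
- exact: abel_continuous.
- by move=> x /=; rewrite mulrN cosN normrN.
rewrite -set_itvcy.
have -> : (\int[mu]_(x in `[0%R, +oo[) ((1 + cos (y * x)) * expR (- e * `|x|))%:E =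
  \int[mu]_(x in `[0%R, +oo[) ((1 + cos (y * x)) * expR (- e * x))%:E)%E.
  apply: eq_integral => x; rewrite inE/= in_itv/= andbT => x0.
  by rewrite ger0_norm.
have dp := is_derive_prim y.
rewrite (@ge0_continuous_FTC2y _ _ (prim y) _ 0)//.
- rewrite /prim -EFinN -EFinD -EFinM; congr EFin.
  rewrite !mulr0 expR0 sin0 cos0; field.
  by rewrite !gt_eqF// ltr_pwDl ?exprn_gt0// sqr_ge0.
- apply: continuous_subspaceT.
  apply: (@is_derive_continuous _ _ (fun x => - y * sin (y * x) * expR (- e * x)
    - e * (1 + cos (y * x)) * expR (- e * x))) => x.
  apply: is_derive_eq; rewrite /GRing.scale/=; ring.
- by apply: cvg_at_right_filter; exact: is_derive_continuous dp _.
- by move=> x _; rewrite derive1E; case: (dp x).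
Qed.

Lemma L1_exp_norm : mu.-L1 (fun x : R => expR (- e * `|x|)).
Proof.
have mn : measurable_fun setT (fun x : R => expR (- e * `|x|)).
  by apply: measurableT_comp => //; exact: measurable_funM.
apply: (@le_L1 _ _ _ mu (fun x : R => (1 + cos (0 * x)) * expR (- e * `|x|)))
    mn _; last first.
  by move=> x; rewrite mul0r cos0 ger0_norm ?expR_ge0// ler_peMl ?expR_ge0// lerDl.
apply/integrableP; split.
  apply/measurable_EFinP; apply: continuous_measurable_fun.
  exact: abel_continuous.
under eq_integral.
  move=> x _; rewrite /= ger0_norm; last first.
    by rewrite mulr_ge0 ?expR_ge0// -lerBlDl sub0r cos_geN1.
  over.
by rewrite integral_exp_cos ltry.
Qed.

Lemma L1_abel (y : R) : mu.-L1 (fun x : R => cos (y * x) * expR (- e * `|x|)).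
Proof.
apply: (le_L1 L1_exp_norm).
  apply: measurable_funM.
    by apply: (measurableT_comp measurable_cos); exact: measurable_funM.
  exact: L1_measurable L1_exp_norm.
move=> x; rewrite normrM (ger0_norm (expR_ge0 _)).
by rewrite ler_piMl ?expR_ge0// cos_max.
Qed.

Lemma Rintegral_abel (y : R) :
  \int[mu]_x (cos (y * x) * expR (- e * `|x|)) = 2 * e / (e ^+ 2 + y ^+ 2).
Proof.
have I0 : \int[mu]_x expR (- e * `|x|) = 2 / e.
  have : 2 * \int[mu]_x expR (- e * `|x|) = 2 / e + 2 * e / (e ^+ 2 + 0 ^+ 2).
    rewrite -RintegralZl//; last exact: L1_exp_norm.
    rewrite /Rintegral; under eq_integral.
      move=> x _; rewrite (_ : 2 * expR (- e * `|x|) =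
        (1 + cos (0 * x)) * expR (- e * `|x|)); last by rewrite mul0r cos0.
      over.
    by rewrite integral_exp_cos.
  move=> H; apply: (@mulfI _ 2) => //; rewrite H; field.
  by rewrite gt_eqF.
have : \int[mu]_x ((1 + cos (y * x)) * expR (- e * `|x|)) =
    2 / e + 2 * e / (e ^+ 2 + y ^+ 2) by rewrite /Rintegral integral_exp_cos.
under eq_Rintegral do rewrite mulrDl mul1r.
rewrite RintegralD//; [|exact: L1_exp_norm|exact: L1_abel].
by rewrite I0 => /addrI.
Qed.

End abel_kernel.

Section poisson_kernel.
Context {R : realType}.
Notation mu := (@lebesgue_measure R).

Definition poisson_kernel (e z : R) := 2 * e / (e ^+ 2 + z ^+ 2).

Lemma poisson_kernel_ge0 (e z : R) : 0 <= e -> 0 <= poisson_kernel e z.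
Proof.
by move=> e0; rewrite divr_ge0// ?addr_ge0 ?sqr_ge0// mulr_ge0.
Qed.

Let is_derive_atanV (e x : R) : 0 < e ->
  is_derive (x : R) (1 : R) (fun x => 2 * atan (e^-1 * x)) (poisson_kernel e x).
Proof.
move=> e0; apply: is_derive_eq; rewrite /GRing.scale/= /poisson_kernel.
field; rewrite (gt_eqF e0)/=.
by rewrite !gt_eqF// ltr_pwDl ?exprn_gt0// sqr_ge0.
Qed.

Lemma continuous_poisson_kernel (e : R) : 0 < e ->
  continuous (poisson_kernel e).
Proof.
move=> e0 x; apply: cvgM; first exact: cvg_cst.
apply: cvgV; first by rewrite gt_eqF// ltr_pwDl ?exprn_gt0// sqr_ge0.
by apply: cvgD; [exact: cvg_cst|exact: exprn_continuous].
Qed.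

Lemma integral_poisson_kernel (e : R) : 0 < e ->
  (\int[mu]_x (poisson_kernel e x)%:E = (2 * pi)%:E)%E.
Proof.
move=> e0.
have ck := continuous_poisson_kernel e0.
have dp x := is_derive_atanV x e0.
rewrite ge0_symfun_integralT; last 3 first.
- by move=> x; exact/poisson_kernel_ge0/ltW.
- exact: ck.
- by move=> x /=; rewrite /poisson_kernel sqrrN.
rewrite -set_itvcy.
rewrite (@ge0_continuous_FTC2y _ _ (fun x => 2 * atan (e^-1 * x)) _ pi)//.
- by rewrite mulr0 atan0 mulr0 sube0.
- by move=> x _; exact/poisson_kernel_ge0/ltW.
- exact: continuous_subspaceT.
- rewrite (_ : pi = 2 * (pi / 2) :> R); last by field.
  apply: cvgM; first exact: cvg_cst.
  apply: (@cvg_comp _ _ _ (fun x : R => e^-1 * x) (@atan R) _ _ _ _ (@cvgy_atan R)).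
  apply/cvgryPge => A; near=> x.
  by rewrite ler_pdivlMl.
- by apply: cvg_at_right_filter; exact: is_derive_continuous dp _.
- by move=> x _; rewrite derive1E; case: (dp x).
Unshelve. all: by end_near. Qed.

Lemma L1_poisson_kernel (e x : R) : 0 < e ->
  mu.-L1 (fun y => poisson_kernel e (y - x)).
Proof.
move=> e0; apply: L1_translate; first exact: continuous_poisson_kernel.
apply/integrableP; split.
  apply/measurable_EFinP; apply: continuous_measurable_fun.
  exact: continuous_poisson_kernel.
under eq_integral.
  move=> y _; rewrite /= ger0_norm; last exact/poisson_kernel_ge0/ltW.
  over.
by rewrite integral_poisson_kernel// ltry.
Qed.

Lemma Rintegral_poisson_kernel (e x : R) : 0 < e ->
  \int[mu]_y poisson_kernel e (y - x) = 2 * pi.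
Proof.
move=> e0; have ck := continuous_poisson_kernel e0.
rewrite (@Rintegral_translate _ (poisson_kernel e))//.
  by rewrite /Rintegral integral_poisson_kernel.
have := L1_poisson_kernel 0 e0.
by under eq_fun do rewrite subr0.
Qed.

End poisson_kernel.

(** * The Poisson kernel as an approximate identity *)

(** Lebesgue measure lives on [measurableTypeR R], which is not the measurable
    structure inferred for [R]. *)
Local Notation mborel := (measurable_fun [set: measurableTypeR _]).
Section poisson_limit.
Context {R : realType}.
Notation mu := (@lebesgue_measure R).

(** Away from the origin the kernel is small in two ways: uniformly, which is
    what an integrable but possibly unbounded function requires, and relatively
    to the kernel of width 1, which keeps it integrable. *)
Lemma poisson_kernel_le_far (e z delta : R) : 0 < e -> 0 < delta ->
  delta <= `|z| ->
  poisson_kernel e z <= 2 * e / delta ^+ 2 /\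
  poisson_kernel e z <= e * (1 + delta ^- 2) * poisson_kernel 1 z.
Proof.
move=> e0 d0 dz; rewrite /poisson_kernel.
have d2 : 0 < delta ^+ 2 by rewrite exprn_gt0.
have dz2 : delta ^+ 2 <= z ^+ 2.
  by rewrite -(real_normK (num_real z)) lerXn2r ?nnegrE// ltW.
have z2 : 0 < z ^+ 2 by exact: lt_le_trans dz2.
have e2 : 0 < e ^+ 2 by rewrite exprn_gt0.
split.
  rewrite ler_pM2l ?mulr_gt0// lef_pV2 ?posrE ?addr_gt0//.
  by rewrite (le_trans dz2)// lerDr ltW.
apply: (@le_trans _ _ (2 * e / z ^+ 2)).
  by rewrite ler_pM2l ?mulr_gt0// lef_pV2 ?posrE ?addr_gt0// lerDr ltW.
rewrite (_ : e * (1 + delta ^- 2) * (2 * 1 / (1 ^+ 2 + z ^+ 2)) =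
   2 * e * ((1 + delta ^- 2) / (1 + z ^+ 2))); last by rewrite expr1n; ring.
rewrite ler_pM2l ?mulr_gt0// ler_pdivlMr ?addr_gt0//.
rewrite mulrC mulrDl mul1r divff ?gt_eqF// addrC lerD2l.
by rewrite lef_pV2 ?posrE.
Qed.

(** Stated for integrable rather than bounded [g]: boundedness is a consequence
    of the inversion formula that this lemma serves to prove.  Near [x], [g] is
    close to [g x]; away from it the kernel is small. *)
Lemma poisson_kernel_approx (g : R -> R) (x : R) (e_ : nat -> R) :
  (forall n, 0 < e_ n) -> e_ n @[n --> \oo] --> 0 ->
  mu.-L1 g -> {for x, continuous g} ->
  \int[mu]_y (g y * poisson_kernel (e_ n) (y - x)) @[n --> \oo]
    --> 2 * pi * g x.
Proof.
move=> e0 e_cvg gi cg.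
have pi0 := @pi_gt0 R.
apply/cvgrPdist_le => eta eta0.
pose eta' := eta / (4 * pi).
have eta'0 : 0 < eta' by rewrite divr_gt0// mulr_gt0.
move/cvgrPdist_le : cg => /(_ _ eta'0)/nbhs_ballP[delta /= d0 Hd].
pose G := \int[mu]_y `|g y|.
pose K := 2 / delta ^+ 2 * G + `|g x| * (1 + delta ^- 2) * (2 * pi).
have cK : e_ n * K @[n --> \oo] --> (0 : R).
  by rewrite -(mul0r K); apply: cvgM => //; exact: cvg_cst.
have eta2 : 0 < eta / 2 by rewrite divr_gt0.
move/cvgrPdist_le : cK => /(_ _ eta2) NK.
near=> n.
have en0 := e0 n.
have Li (e : R) : 0 < e -> mu.-L1 (fun y => poisson_kernel e (y - x)).
  exact: L1_poisson_kernel.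
have mP (e : R) : 0 < e -> mborel (fun y : R => poisson_kernel e (y - x)).
  by move=> ?; apply: (L1_measurable (Li _ _)).
have mg := L1_measurable gi.
(* the first term bounds the contribution of |y - x| < delta, the two others
   that of g y and of g x on the complement *)
pose D (y : R) := eta' * poisson_kernel (e_ n) (y - x) +
  (2 * e_ n / delta ^+ 2 * `|g y| +
   `|g x| * (e_ n * (1 + delta ^- 2)) * poisson_kernel 1 (y - x)).
have key y : `|(g x - g y) * poisson_kernel (e_ n) (y - x)| <= D y.
  have P0 (e : R) : 0 < e -> 0 <= poisson_kernel e (y - x).
    by move=> /ltW; exact: poisson_kernel_ge0.
  rewrite normrM (ger0_norm (P0 _ en0)).
  have [yd|yd] := ltP `|y - x| delta.
    rewrite /D -[leLHS]addr0 lerD//.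
      by rewrite ler_wpM2r ?P0// Hd//= /ball/= distrC.
    rewrite addr_ge0//; first by rewrite mulr_ge0// divr_ge0 ?sqr_ge0// mulr_ge0// ltW.
    by rewrite mulr_ge0 ?P0// mulr_ge0// mulr_ge0 ?(ltW en0)// addr_ge0// invr_ge0 sqr_ge0.
  have [k1 k2] := poisson_kernel_le_far en0 d0 yd.
  rewrite /D -[leLHS]add0r lerD//; first by rewrite mulr_ge0 ?P0// ltW.
  apply: (@le_trans _ _ ((`|g x| + `|g y|) * poisson_kernel (e_ n) (y - x))).
    by rewrite ler_wpM2r ?P0// ler_normB.
  rewrite mulrDl addrC lerD//.
    by rewrite mulrC ler_wpM2r.
  by rewrite -[leRHS]mulrA ler_wpM2l.
have D1 := L1Z eta' (Li _ en0).
have D2 := L1Z (2 * e_ n / delta ^+ 2) (L1_norm gi).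
have D3 := L1Z (`|g x| * (e_ n * (1 + delta ^- 2))) (Li _ ltr01).
have Di : mu.-L1 D by exact: L1D D1 (L1D D2 D3).
have DE : \int[mu]_y D y = eta / 2 + e_ n * K.
  rewrite /D (RintegralD measurableT D1 (L1D D2 D3))// (RintegralD measurableT D2 D3)//.
  rewrite (RintegralZl _ measurableT (Li _ en0))// (RintegralZl _ measurableT (L1_norm gi))//.
  rewrite (RintegralZl _ measurableT (Li _ ltr01))// !Rintegral_poisson_kernel// -/G.
  rewrite /eta' /K; move: (gt_eqF pi0); generalize (@pi R) => p p0.
  by field; rewrite gt_eqF//= p0.
have dm : mborel (fun y : R => (g x - g y) * poisson_kernel (e_ n) (y - x)).
  by apply: measurable_funM; [exact: measurable_funB|exact: mP].
have di := le_L1 Di dm key.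
have -> : 2 * pi * g x - \int[mu]_y (g y * poisson_kernel (e_ n) (y - x)) =
    \int[mu]_y ((g x - g y) * poisson_kernel (e_ n) (y - x)).
  rewrite -(Rintegral_poisson_kernel x en0) mulrC -RintegralZl//; last exact: Li.
  rewrite -RintegralB//; last 2 first.
  - by apply: L1Z; exact: Li.
  - have := L1B (L1Z (g x) (Li _ en0)) di.
    by apply: eq_integrable => // y _ /=; congr EFin; ring.
  by apply: eq_Rintegral => y _; rewrite mulrBl.
rewrite (le_trans (le_norm_Rintegral Di dm key))//.
rewrite DE [X in _ <= X](_ : _ = eta / 2 + eta / 2); last by field.
rewrite lerD2l (le_trans (ler_norm _))//.
by rewrite -normrN -sub0r; near: n.
Unshelve. all: by end_near. Qed.

End poisson_limit.

(** * Fourier inversion *)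

Lemma continuous_Rintegral_param d (T : measurableType d) (R : realType)
    (mu : {measure set T -> \bar R}) (f : R -> T -> R) (g : T -> R) :
  (forall x, measurable_fun setT (f x)) -> (forall y, continuous (f ^~ y)) ->
  mu.-L1 g -> (forall x y, `|f x y| <= g y) ->
  continuous (fun x => \int[mu]_y f x y).
Proof.
move=> mf cf gi fg x.
apply: (@continuity_under_integral R _ _ mu f setT measurableT (x - 1) (x + 1)
  _ _ g gi).
- by move=> z _; exact: le_L1 gi (mf z) (fg z).
- by apply: aeW => y _ z _; exact: cf.
- by move=> z _; apply: aeW => y _; exact: fg.
- by apply/mem_set => /=; rewrite in_itv/= ltrBlDr ltrDl ltr01.
Qed.

Section complex_valued.
Context {R : realType}.
Notation mu := (@lebesgue_measure R).
Notation normc := (@Normc.normc R).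

(** The real part of exp (- i th) z.  Working with all phases [th] at once treats
    the real part ([th = 0]) and the imaginary part ([th = pi / 2]) of a complex
    integral together. *)
Definition rotRe (th : R) (z : R[i]) : R :=
  cos th * complex.Re z + sin th * complex.Im z.

Lemma normc_ge0 (z : R[i]) : 0 <= normc z.
Proof. by case: z => a b; exact: sqrtr_ge0. Qed.

(** Cauchy-Schwarz for the vectors (cos th, sin th) and (Re z, Im z). *)
Lemma rotRe_le (th : R) z : `|rotRe th z| <= normc z.
Proof.
case: z => a b; rewrite /rotRe/= -sqrtr_sqr ler_wsqrtr//.
have h := cos2Dsin2 th.
rewrite -[leRHS]mul1r -h -subr_ge0.
set c := cos th; set s := sin th.
rewrite (_ : _ - _ = (c * b - s * a) ^+ 2); last by ring.
exact: sqr_ge0.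
Qed.

Lemma Re_rotRe z : complex.Re z = rotRe 0 z.
Proof. by rewrite /rotRe cos0 sin0 mul1r mul0r addr0. Qed.

Lemma Im_rotRe z : complex.Im z = rotRe (pi / 2) z.
Proof. by rewrite /rotRe cos_pihalf sin_pihalf mul1r mul0r add0r. Qed.

Lemma rotReD th z w : rotRe th (z + w) = rotRe th z + rotRe th w.
Proof. by case: z w => [a b] [c d]; rewrite /rotRe/=; ring. Qed.

Lemma rotReZ th r z : rotRe th (r%:C%C * z) = r * rotRe th z.
Proof. by case: z => [a b]; rewrite /rotRe/=; ring. Qed.

Section cmeasurable.
Context d (T : measurableType d).
Implicit Types F G : T -> R[i].

Definition cmeasurable F :=
  measurable_fun setT (fun x => complex.Re (F x)) /\
  measurable_fun setT (fun x => complex.Im (F x)).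

Lemma cmeasurableM F G : cmeasurable F -> cmeasurable G ->
  cmeasurable (fun x => F x * G x).
Proof.
move=> [mF1 mF2] [mG1 mG2]; split.
- rewrite (_ : (fun _ => _) = (fun x => complex.Re (F x) * complex.Re (G x) -
     complex.Im (F x) * complex.Im (G x))); last first.
    by apply/funext => x; case: (F x) (G x) => [a b] [c e].
  by apply: measurable_funB; exact: measurable_funM.
- rewrite (_ : (fun _ => _) = (fun x => complex.Re (F x) * complex.Im (G x) +
     complex.Im (F x) * complex.Re (G x))); last first.
    by apply/funext => x; case: (F x) (G x) => [a b] [c e].
  by apply: measurable_funD; exact: measurable_funM.
Qed.

Lemma cmeasurableD F G : cmeasurable F -> cmeasurable G ->
  cmeasurable (fun x => F x + G x).
Proof.
move=> [mF1 mF2] [mG1 mG2]; split.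
- rewrite (_ : (fun _ => _) = (fun x => complex.Re (F x) + complex.Re (G x))).
    exact: measurable_funD.
  by apply/funext => x; case: (F x) (G x) => [a b] [c e].
- rewrite (_ : (fun _ => _) = (fun x => complex.Im (F x) + complex.Im (G x))).
    exact: measurable_funD.
  by apply/funext => x; case: (F x) (G x) => [a b] [c e].
Qed.

Lemma cmeasurable_cst (z : R[i]) : cmeasurable (fun=> z).
Proof. by split; exact: measurable_cst. Qed.

Lemma measurable_rotRe F (th : T -> R) : cmeasurable F ->
  measurable_fun setT th -> measurable_fun setT (fun x => rotRe (th x) (F x)).
Proof.
move=> [mF1 mF2] mth; apply: measurable_funD; apply: measurable_funM => //.
- exact: (measurableT_comp measurable_cos).
- exact: (measurableT_comp measurable_sin).
Qed.

Lemma measurable_normc F : cmeasurable F ->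
  measurable_fun setT (fun x => normc (F x)).
Proof.
move=> [mF1 mF2].
rewrite (_ : (fun _ => _) = (fun x => Num.sqrt (complex.Re (F x) ^+ 2 +
  complex.Im (F x) ^+ 2))); last first.
  by apply/funext => x; case: (F x).
apply: (@measurableT_comp _ _ _ _ _ _ (@Num.sqrt R)).
  apply: continuous_measurable_fun; exact: sqrt_continuous.
by apply: measurable_funD; exact: measurable_funX.
Qed.

End cmeasurable.

Definition cintegrable (F : R -> R[i]) :=
  cmeasurable (F : measurableTypeR R -> R[i]) /\ mu.-L1 (fun x => normc (F x)).

Lemma le_cintegrable (g : R -> R) F : mu.-L1 g ->
  cmeasurable (F : measurableTypeR R -> R[i]) ->
  (forall x, normc (F x) <= g x) -> cintegrable F.
Proof.
move=> gi mF Fg; split => //; apply: le_L1 gi _ _.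
  exact: measurable_normc.
by move=> x; rewrite ger0_norm// normc_ge0.
Qed.

Lemma cintegrableM_bounded (K : R) m F :
  cmeasurable (m : measurableTypeR R -> R[i]) -> (forall x, normc (m x) <= K) ->
  cintegrable F -> cintegrable (fun x => m x * F x).
Proof.
move=> mm mK [mF Fi]; apply: (le_cintegrable (L1Z K Fi)).
  exact: cmeasurableM.
by move=> x; rewrite Normc.normcM ler_wpM2r ?normc_ge0.
Qed.

Lemma L1_rotRe F (x : R) : cintegrable F ->
  mu.-L1 (fun xi => rotRe (x * xi) (F xi)).
Proof.
move=> [mF Fi]; apply: le_L1 Fi _ _ => [|xi]; last exact: rotRe_le.
by apply: measurable_rotRe => //; exact: measurable_funM.
Qed.

(** The real part of the inverse Fourier transform; for the transform of a real
    function, the imaginary part vanishes. *)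
Definition inv_ft (F : R -> R[i]) (x : R) : R :=
  (2 * pi)^-1 * \int[mu]_xi rotRe (x * xi) (F xi).

Lemma inv_ft_le F x : cintegrable F ->
  `|inv_ft F x| <= (2 * pi)^-1 * \int[mu]_xi normc (F xi).
Proof.
move=> Fi; have p0 : 0 <= (2 * pi)^-1 :> R by rewrite invr_ge0 mulr_ge0// pi_ge0.
rewrite normrM ger0_norm// ler_wpM2l//.
apply: le_norm_Rintegral; [by case: Fi|exact: L1_measurable (L1_rotRe _ Fi)|].
by move=> xi; exact: rotRe_le.
Qed.

Lemma inv_ftD F G x : cintegrable F -> cintegrable G ->
  inv_ft (fun xi => F xi + G xi) x = inv_ft F x + inv_ft G x.
Proof.
move=> Fi Gi; rewrite /inv_ft -mulrDr -RintegralD//; [|exact: L1_rotRe|exact: L1_rotRe].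
by congr (_ * _); apply: eq_Rintegral => xi _; rewrite rotReD.
Qed.

Lemma inv_ftZ F (r x : R) : cintegrable F ->
  inv_ft (fun xi => r%:C%C * F xi) x = r * inv_ft F x.
Proof.
move=> Fi; rewrite /inv_ft mulrCA -(RintegralZl _ measurableT (L1_rotRe x Fi)).
by congr (_ * _); apply: eq_Rintegral => xi _; rewrite rotReZ.
Qed.

Definition ft (g : R -> R) (xi : R) : R[i] :=
  ((\int[mu]_x (cos (x * xi) * g x)) +i* (\int[mu]_x (sin (x * xi) * g x)))%C.

Lemma L1_trigoM (trig h g : R -> R) : mborel trig -> (forall x, `|trig x| <= 1) ->
  mborel h -> mu.-L1 g -> mu.-L1 (fun x => trig (h x) * g x).
Proof.
move=> mt t1 mh gi; apply: le_L1 (L1_norm gi) _ _.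
  by apply: measurable_funM; [exact: measurableT_comp|exact: L1_measurable gi].
by move=> x; rewrite normrM ler_piMl.
Qed.

Lemma L1_cosM (h g : R -> R) : mborel h -> mu.-L1 g ->
  mu.-L1 (fun x => cos (h x) * g x).
Proof. by apply: L1_trigoM; [exact: measurable_cos|exact: cos_max]. Qed.

Lemma L1_sinM (h g : R -> R) : mborel h -> mu.-L1 g ->
  mu.-L1 (fun x => sin (h x) * g x).
Proof. by apply: L1_trigoM; [exact: measurable_sin|exact: sin_max]. Qed.

Lemma rotRe_ft g th xi : mu.-L1 g ->
  rotRe th (ft g xi) = \int[mu]_y (cos (y * xi - th) * g y).
Proof.
move=> gi; have mx : mborel (fun y : R => y * xi) by exact: measurable_funM.
have ci := L1_cosM mx gi; have si := L1_sinM mx gi.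
rewrite /rotRe/= -(RintegralZl _ measurableT ci) -(RintegralZl _ measurableT si).
rewrite -RintegralD//; [|exact: L1Z|exact: L1Z].
by apply: eq_Rintegral => y _; rewrite cosB; ring.
Qed.

Lemma continuous_ft g : mu.-L1 g ->
  continuous (fun xi => complex.Re (ft g xi)) /\
  continuous (fun xi => complex.Im (ft g xi)).
Proof.
move=> gi; have mg := L1_measurable gi.
split; rewrite /=.
- apply: (continuous_Rintegral_param _ _ (L1_norm gi)) => [xi|y xi|xi y].
  + by apply: L1_measurable (L1_cosM _ gi); exact: measurable_funM.
  + apply: cvgM; last exact: cvg_cst.
    apply: (@continuous_comp _ _ _ (fun xi : R => y * xi)); last exact: continuous_cos.
    exact: mulrl_continuous.
  + by rewrite normrM ler_piMl// cos_max.
- apply: (continuous_Rintegral_param _ _ (L1_norm gi)) => [xi|y xi|xi y].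
  + by apply: L1_measurable (L1_sinM _ gi); exact: measurable_funM.
  + apply: cvgM; last exact: cvg_cst.
    apply: (@continuous_comp _ _ _ (fun xi : R => y * xi)); last exact: continuous_sin.
    exact: mulrl_continuous.
  + by rewrite normrM ler_piMl// sin_max.
Qed.

Lemma cmeasurable_ft g : mu.-L1 g ->
  cmeasurable (ft g : measurableTypeR R -> R[i]).
Proof.
by move=> /continuous_ft[c1 c2]; split; exact: continuous_measurable_fun.
Qed.

(** Inserting the factor exp (- e |xi|) makes the inversion integral absolutely
    convergent as a double integral; by Fubini's theorem it becomes a convolution
    with the Poisson kernel. *)
Lemma Rintegral_rotRe_ft_abel (g : R -> R) (e x : R) : 0 < e -> mu.-L1 g ->
  \int[mu]_xi (rotRe (x * xi) (ft g xi) * expR (- e * `|xi|)) =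
  \int[mu]_y (g y * poisson_kernel e (y - x)).
Proof.
move=> e0 gi; have mg := L1_measurable gi.
pose k (xi y : R) := expR (- e * `|xi|) * (cos ((y - x) * xi) * g y).
have ci xi : mu.-L1 (fun y => cos ((y - x) * xi) * g y).
  by apply: L1_cosM => //; apply: measurable_funM => //; exact: measurable_funB.
have mk : measurable_fun [set: measurableTypeR R * measurableTypeR R]
    (fun z => k z.1 z.2).
  apply: measurable_funM.
    apply: (@measurableT_comp _ _ _ _ _ _ (@expR R)) => //.
    by apply: measurable_funM => //; exact: measurableT_comp.
  apply: measurable_funM; last exact: measurableT_comp.
  apply: (@measurableT_comp _ _ _ _ _ _ (@cos R)); first exact: measurable_cos.
  by apply: measurable_funM => //; exact: measurable_funB.
have k1 xi : mu.-L1 (k xi) by exact: L1Z.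
have kE y : k ^~ y = fun xi => g y * (cos ((y - x) * xi) * expR (- e * `|xi|)).
  by apply/funext => xi; rewrite /k; ring.
have k2 y : mu.-L1 (k ^~ y) by rewrite kE; apply: L1Z; exact: L1_abel.
have k3 xi : \int[mu]_y `|k xi y| <= \int[mu]_y `|g y| * expR (- e * `|xi|).
  rewrite -RintegralZr//; last exact: L1_norm.
  apply: le_Rintegral => //; first exact: L1_norm.
    by under eq_fun do rewrite mulrC; apply: L1Z; exact: L1_norm.
  move=> y _; rewrite /k normrM (ger0_norm (expR_ge0 _)) mulrC ler_wpM2r ?expR_ge0//.
  by rewrite normrM ler_piMl// cos_max.
have k4 : mu.-L1 (fun xi : R => \int[mu]_y `|g y| * expR (- e * `|xi|)).
  by apply: L1Z; exact: L1_exp_norm.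
have [_ _ E] := RFubini mk k1 k2 k3 k4.
transitivity (\int[mu]_xi \int[mu]_y k xi y).
  apply: eq_Rintegral => xi _; rewrite /k RintegralZl// mulrC rotRe_ft//.
  by congr (_ * _); apply: eq_Rintegral => y _; rewrite mulrBl.
rewrite E; apply: eq_Rintegral => y _; rewrite kE RintegralZl ?Rintegral_abel//.
exact: L1_abel.
Qed.

Lemma expR_norm_le1 (e x : R) : 0 <= e -> expR (- e * `|x|) <= 1.
Proof. by move=> e0; rewrite -expR0 ler_expR mulNr oppr_le0 mulr_ge0. Qed.

(** The two sides of [Rintegral_rotRe_ft_abel] have limits as [e] tends to 0: the
    left one by dominated convergence, the right one because the Poisson kernel
    is an approximate identity. *)
Lemma ft_inversion (g : R -> R) (x : R) : continuous g -> mu.-L1 g ->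
  cintegrable (ft g) -> g x = inv_ft (ft g) x.
Proof.
move=> cg gi Fi; have p0 : 2 * pi != 0 :> R by rewrite mulf_neq0// gt_eqF// pi_gt0.
apply: (mulfI p0); rewrite /inv_ft mulrA divff// mul1r.
pose e_ (n : nat) : R := n.+1%:R^-1.
have e0 n : 0 < e_ n by rewrite invr_gt0.
have ecvg : e_ n @[n --> \oo] --> (0 : R) by exact: cvg_harmonic.
have H1 := poisson_kernel_approx e0 ecvg gi (cg x).
have H2 : \int[mu]_xi (rotRe (x * xi) (ft g xi) * expR (- e_ n * `|xi|)) @[n --> \oo]
    --> \int[mu]_xi rotRe (x * xi) (ft g xi).
  have mr := L1_measurable (L1_rotRe x Fi).
  apply: (@dominated_cvg_R _ (measurableTypeR R) R mu
    (fun n xi => rotRe (x * xi) (ft g xi) * expR (- e_ n * `|xi|)) _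
    (fun xi => Normc.normc (ft g xi))).
  - by move=> n; apply: measurable_funM => //; exact: L1_measurable (L1_exp_norm (e0 n)).
  - move=> xi; rewrite -[X in _ --> X]mulr1 -expR0 -[X in expR X](mul0r `|xi|) -oppr0.
    apply: cvgM; first exact: cvg_cst.
    apply: (cvg_comp (fun n => - e_ n * `|xi|) (@expR R)); last exact: continuous_expR.
    by apply: cvgM; [exact: cvgN|exact: cvg_cst].
  - by case: Fi.
  - move=> n xi; rewrite normrM (ger0_norm (expR_ge0 _)).
    rewrite (le_trans _ (rotRe_le (x * xi) _))// ler_piMr// expR_norm_le1//.
    exact: ltW.
have E : (fun n => \int[mu]_xi (rotRe (x * xi) (ft g xi) * expR (- e_ n * `|xi|))) =
    (fun n => \int[mu]_y (g y * poisson_kernel (e_ n) (y - x))).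
  by apply/funext => n; exact: Rintegral_rotRe_ft_abel.
by rewrite E in H2; exact: (cvg_unique _ H1 H2).
Qed.

End complex_valued.

(** * Uniform convergence and complex integrability *)

Lemma uniform_cvgP (R : realType) (s : nat -> R -> R) (h : R -> R) :
  {uniform, s @ \oo --> h} <->
  forall e, 0 < e -> \forall n \near \oo, forall x, `|h x - s n x| <= e.
Proof.
split=> [sh e e0|H P /uniform_nbhs[E [entE EP]]].
  have : nbhs (h : {uniform R -> R}) [set h' | forall x, `|h x - h' x| <= e].
    apply/uniform_nbhs; exists [set xy | ball xy.1 e xy.2]; split.
      exact: entourage_ball (PosNum e0).
    by move=> h' /= H x; exact/ltW/H.
  by move=> /sh.
move: entE; rewrite -entourage_ballE => -[e /= e0 eE].
have e2 : 0 < e / 2 by rewrite divr_gt0.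
near=> n; apply: EP => x _; apply: eE; rewrite /= /ball/=.
apply: (@le_lt_trans _ _ (e / 2)); last by rewrite ltr_pdivrMr// ltr_pMr// ltr1n.
have : forall x, `|h x - s n x| <= e / 2 by near: n; exact: H.
exact.
Unshelve. all: by end_near. Qed.

Section cintegrable_facts.
Context {R : realType}.
Notation normc := (@Normc.normc R).

Lemma normcN (z : R[i]) : normc (- z) = normc z.
Proof. by case: z => a b; rewrite /= !sqrrN. Qed.

Lemma normcX (z : R[i]) n : normc (z ^+ n) = normc z ^+ n.
Proof. by elim: n => [|n IH]; rewrite ?Normc.normc1// !exprS Normc.normcM IH. Qed.

Lemma normcD_le (z w : R[i]) : normc (z + w) <= normc z + normc w.
Proof. exact: le_normcD. Qed.

Lemma cintegrableD (F G : R -> R[i]) : cintegrable F -> cintegrable G ->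
  cintegrable (fun x => F x + G x).
Proof.
move=> [mF Fi] [mG Gi]; apply: (le_cintegrable (L1D Fi Gi)).
  exact: cmeasurableD.
by move=> x; exact: normcD_le.
Qed.

Lemma cintegrableZ (z : R[i]) (F : R -> R[i]) : cintegrable F ->
  cintegrable (fun x => z * F x).
Proof.
by apply: (@cintegrableM_bounded _ (normc z)) => //; exact: cmeasurable_cst.
Qed.

End cintegrable_facts.

(** * Improper Riemann integrals of continuous functions *)

Section bridge.
Implicit Types f g : RR -> RR.
Notation mu := (@lebesgue_measure RR).

Lemma continuous_coquelicot f x : continuous f ->
  @Continuity.continuous Hierarchy.R_UniformSpace Hierarchy.R_UniformSpace f x.
Proof.
move=> cf; apply/Hierarchy.continuity_pt_filterlim.
by apply/continuity_pt_cvg; exact: cf.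
Qed.

Lemma is_derive_coquelicot f (x l : RR) :
  @Derive.is_derive Hierarchy.R_AbsRing Hierarchy.R_NormedModule f x l ->
  is_derive (x : RR) (1 : RR) f l.
Proof.
move=> /Derive.is_derive_Reals fl.
have H : h^-1 *: (f (h *: (1 : RR) + x) - f x) @[h --> (0 : RR)^'] --> (l : RR).
  apply/cvgrPdist_lt => e /RltP e0.
  have [[d /= /RltP d0] Hd] := fl e e0.
  exists d => //= h /=; rewrite sub0r normrN => hd h0.
  have hd' : Rdefinitions.Rlt (Rbasic_fun.Rabs h) d by apply/RltP; rewrite RabsE.
  have /RltP := Hd h (elimN eqP h0) hd'.
  rewrite RabsE RminusE RdivE RminusE RplusE distrC.
  by rewrite /GRing.scale/= mulr1 mulrC (addrC h).
apply: DeriveDef; first by apply/cvg_ex; exists l.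
exact/cvg_lim.
Qed.

(** Both integrals are increments of the same primitive, by the fundamental
    theorem of calculus on either side. *)
Lemma is_RInt_Rintegral f (a b : RR) : continuous f -> a <= b ->
  @RInt.is_RInt Hierarchy.R_NormedModule f a b (\int[mu]_(x in `[a, b]) f x).
Proof.
move=> cf; have cfC x := @continuous_coquelicot f x cf.
have ex c d : @RInt.ex_RInt Hierarchy.R_NormedModule f c d.
  by apply: (@RInt.ex_RInt_continuous Hierarchy.R_CompleteNormedModule).
pose F : RR -> RR := fun x => @RInt.RInt Hierarchy.R_CompleteNormedModule f a x.
have FI x : @RInt.is_RInt Hierarchy.R_NormedModule f a x (F x).
  exact: (@RInt.RInt_correct Hierarchy.R_CompleteNormedModule).
have dF x : is_derive (x : RR) (1 : RR) F (f x).
  apply: is_derive_coquelicot.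
  apply: (@RInt_analysis.is_derive_RInt Hierarchy.R_NormedModule f F a x).
    by apply: Hierarchy.filter_forall.
  exact: cfC.
have Fa0 : F a = 0 by exact: (@RInt.RInt_point Hierarchy.R_CompleteNormedModule).
rewrite le_eqVlt => /predU1P[<-|ab].
  by rewrite set_itv1 Rintegral_set1 -[X in RInt.is_RInt _ _ _ X]Fa0.
suff -> : \int[mu]_(x in `[a, b]) f x = F b by exact: FI.
have cF x : {for x, continuous F}.
  by apply: differentiable_continuous; apply/derivable1_diffP; case: (dF x).
rewrite /Rintegral (@continuous_FTC2 _ f F)//.
- by rewrite Fa0 sube0.
- exact: continuous_subspaceT.
- split.
  + by move=> x _; case: (dF x).
  + by apply: cvg_at_right_filter; exact: cF.
  + by apply: cvg_at_left_filter; exact: cF.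
- by move=> x _; rewrite derive1E; case: (dF x).
Qed.

Lemma ge0_cvg_Rintegral_symitv (f : RR -> RR) : measurable_fun setT f ->
  (forall x, 0 <= f x) ->
  (\int[mu]_(x in `[(- n%:R)%R, (n%:R)%R]) (f x)%:E @[n --> \oo]
     --> \int[mu]_x (f x)%:E)%E.
Proof.
move=> mf f0.
have := @ge0_nondecreasing_set_cvg_integral _ (measurableTypeR RR) RR
  (fun n => `[- n%:R, n%:R]%classic : set RR) (EFin \o f) mu.
rewrite (bigcup_itvT true false); apply => //.
- apply/nondecreasing_seqP => n; apply/subsetPset => x /=.
  rewrite !in_itv/= => /andP[nx xn].
  rewrite (le_trans _ nx) ?(le_trans xn)// ?lerN2 ler_nat //.
- by move=> n; apply/measurable_EFinP; exact: measurable_funTS.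
- by move=> n x _; rewrite lee_fin.
Qed.

Lemma integrable_continuous_itv f (a b : RR) : continuous f ->
  mu.-integrable `[a, b] (EFin \o f).
Proof.
move=> cf; apply: continuous_compact_integrable; first exact: segment_compact.
exact: continuous_subspaceT.
Qed.

Lemma locally_norm_lt (l e : RR) : 0 < e ->
  @Hierarchy.locally Hierarchy.R_UniformSpace l (fun y : RR => `|y - l| < e).
Proof.
move=> /RltP e0; exists (RIneq.mkposreal e e0) => y /RltP.
by rewrite /Hierarchy.abs/= RabsE /Hierarchy.minus/= /Hierarchy.plus/=.
Qed.

(** Convergence of the improper integral bounds the integrals of |f| over
    [-n, n], which increase to the Lebesgue integral. *)
Lemma Lc_L1 f : continuous f -> Lc f -> mu.-L1 f.
Proof.
move=> cf [_ [l Hl]].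
have cn := continuous_normf cf.
have [P Q [M1 HP] [M2 HQ] PQ] := Hl _ (locally_norm_lt l (ltr01 : 0 < (1 : RR))).
have mf : measurable_fun setT f by exact: continuous_measurable_fun.
apply/integrableP; split; first exact/measurable_EFinP.
apply: (@le_lt_trans _ _ (l + 1)%:E); last exact: ltry.
have /= := ge0_cvg_Rintegral_symitv (continuous_measurable_fun cn)
  (fun=> normr_ge0 _).
move=> /cvge_to_le; apply; near=> n.
have nM1 : Rdefinitions.Rlt (- n%:R) M1.
  by apply/RltP; rewrite ltrNl; near: n; exact: nbhs_infty_gtr.
have nM2 : Rdefinitions.Rlt M2 n%:R.
  by apply/RltP; near: n; exact: nbhs_infty_gtr.
have [y [Iy yl]] := PQ _ _ (HP _ nM1) (HQ _ nM2).
have ab : - n%:R <= n%:R :> RR by rewrite (@le_trans _ _ 0)// oppr_le0.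
have yE : y = \int[mu]_(x in `[- n%:R, n%:R]) `|f x|.
  have := is_RInt_Rintegral cn ab.
  by move=> /(@RInt.is_RInt_unique Hierarchy.R_CompleteNormedModule) <-;
    apply/esym/(@RInt.is_RInt_unique Hierarchy.R_CompleteNormedModule).
have -> : (\int[mu]_(x in `[(- n%:R)%R, (n%:R)%R]) (`|f x|)%:E)%E = y%:E.
  by rewrite yE fineK//; apply: integrable_fin_num => //; exact: integrable_continuous_itv.
rewrite lee_fin; move: yl; rewrite ltr_norml => /andP[_ /ltW].
by rewrite lerBlDr addrC.
Unshelve. all: by end_near. Qed.

(** For a <= -N and N <= b, the error is at most the integral of |f| outside
    [-N, N], which is small for large N. *)
Lemma is_RInt_gen_Rintegral f : continuous f -> mu.-L1 f ->
  @RInt_gen.is_RInt_gen Hierarchy.R_NormedModule f minfty pinfty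
    (\int[mu]_x f x).
Proof.
move=> cf fi P [[e e0'] eP]; have /RltP e0 := e0'.
have cn := continuous_normf cf.
have fiI (a b : RR) : mu.-integrable `[a, b] (EFin \o f).
  exact: integrable_continuous_itv.
have niI (a b : RR) : mu.-integrable `[a, b] (EFin \o (fun x => `|f x|)).
  exact: integrable_continuous_itv.
have ni := L1_norm fi.
have /= H := ge0_cvg_Rintegral_symitv (continuous_measurable_fun cn)
  (fun=> normr_ge0 _).
have {}H : (\int[mu]_(x in `[- n%:R, n%:R]) `|f x|) @[n --> \oo]
    --> \int[mu]_x `|f x|.
  by apply: fine_cvg; rewrite EFin_Rintegral.
have /cvgrPdist_lt/(_ e e0)[N _ /(_ N (leqnn N)) HN] := H.
apply: (@Hierarchy.Filter_prod _ _ _ _ _ (fun a : RR => a <= - N%:R)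
  (fun b : RR => N%:R <= b)).
- by exists (- N%:R) => x /RltP/ltW.
- by exists (N%:R) => x /RltP/ltW.
move=> a b /= aN Nb.
have ab : a <= b by rewrite (le_trans aN)// (le_trans _ Nb)// (@le_trans _ _ 0)// oppr_le0.
exists (\int[mu]_(x in `[a, b]) f x); split; first exact: is_RInt_Rintegral.
apply: eP; apply/RltP; rewrite /Hierarchy.abs/= RabsE.
rewrite /Hierarchy.minus/= /Hierarchy.plus/= /Hierarchy.opp/= RplusE RoppE.
have split_itv (g : RR -> RR) : mu.-L1 g -> \int[mu]_x g x =
    \int[mu]_(x in `[a, b]) g x + \int[mu]_(x in ~` `[a, b]) g x.
  move=> gi; rewrite -Rintegral_setU ?setUv//.
  - exact: measurableC.
  - exact/disj_setPCl.
rewrite distrC (split_itv f)// addrC addKr.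
apply: le_lt_trans HN; rewrite (split_itv _ ni).
have miC : mu.-integrable (~` `[a, b]) (EFin \o f).
  by apply: integrableS fi => //; exact: measurableC.
rewrite (le_trans (le_normr_Rintegral _ miC))//; first exact: measurableC.
apply: le_trans (ler_norm _).
rewrite addrAC lerDr subr_ge0.
apply: fine_le; [exact: integrable_fin_num|exact: integrable_fin_num|].
apply: ge0_subset_integral => //.
- by apply/measurable_EFinP; exact: measurable_funTS (continuous_measurable_fun cn).
- move=> x /=; rewrite !in_itv/= => /andP[ax xb].
  by rewrite (le_trans aN)//= (le_trans _ Nb).
Qed.

Lemma improperE f : continuous f -> mu.-L1 f -> improper f = \int[mu]_x f x.
Proof.
move=> cf fi; have := is_RInt_gen_Rintegral cf fi.
by move=> /(@RInt_gen.is_RInt_gen_unique Hierarchy.R_CompleteNormedModule).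
Qed.

Lemma L1_Lc f : continuous f -> mu.-L1 f -> Lc f.
Proof.
move=> cf fi; split=> [b c|].
  apply: (@RInt.ex_RInt_continuous Hierarchy.R_CompleteNormedModule) => z _.
  exact: continuous_coquelicot.
exists (\int[mu]_x `|f x|).
by apply: is_RInt_gen_Rintegral; [exact: continuous_normf|exact: L1_norm].
Qed.

End bridge.

(** * The complex exponential and multiplier semigroups *)

Local Notation normc := (@Normc.normc RR).
Local Notation mu := (@lebesgue_measure RR).

Section cexp_facts.
Implicit Types z w c : RR[i].

Lemma cexp0 : cexp 0 = 1.
Proof. by rewrite /cexp/= expR0 cos0 sin0 mulr1 mulr0. Qed.

Lemma cexpD z w : cexp (z + w) = cexp z * cexp w.
Proof.
case: z w => [a b] [c e]; rewrite /cexp/= expRD cosD sinD.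
by congr (_ +i* _)%C; ring.
Qed.

Lemma normc_cexp z : normc (cexp z) = expR (complex.Re z).
Proof.
rewrite /cexp/= !exprMn -mulrDr cos2Dsin2 mulr1 sqrtr_sqr.
by rewrite ger0_norm// expR_ge0.
Qed.

Lemma normc_cexp_le1 z : complex.Re z <= 0 -> normc (cexp z) <= 1.
Proof. by move=> z0; rewrite normc_cexp -expR0 ler_expR. Qed.

Lemma ReZ (s : RR) z : complex.Re (s%:C%C * z) = s * complex.Re z.
Proof. by case: z => a b /=; rewrite mul0r subr0. Qed.

Lemma cmeasurable_cexp d (T : measurableType d) (F : T -> RR[i]) :
  cmeasurable F -> cmeasurable (fun x => cexp (F x)).
Proof.
move=> [mF1 mF2]; split; apply: measurable_funM.
- exact: (measurableT_comp (@measurable_expR RR)).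
- exact: (measurableT_comp (@measurable_cos RR)).
- exact: (measurableT_comp (@measurable_expR RR)).
- exact: (measurableT_comp (@measurable_sin RR)).
Qed.

Lemma is_derive_rotRe_cexp th z c (s : RR) :
  is_derive (s : RR) (1 : RR) (fun s : RR => rotRe th (cexp (s%:C%C * z) * c))
    (rotRe th (z * (cexp (s%:C%C * z) * c))).
Proof.
case: z c => [p q] [a b].
have E (t : RR) : cexp (t%:C%C * (p +i* q)%C) =
    ((expR (t * p) * cos (t * q)) +i* (expR (t * p) * sin (t * q)))%C.
  by rewrite /cexp/= !mul0r subr0 addr0.
rewrite (_ : (fun _ => _) = (fun t : RR =>
  cos th * (expR (t * p) * cos (t * q) * a - expR (t * p) * sin (t * q) * b) +
  sin th * (expR (t * p) * cos (t * q) * b + expR (t * p) * sin (t * q) * a))); last first.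
  by apply/funext => t; rewrite E.
apply: is_derive_eq; rewrite E /rotRe/= /GRing.scale/=; ring.
Qed.

(** The second derivative of exp (s z) c in [s] is exp (s z) z^2 c. *)
Lemma rotRe_cexp_taylor2 th z c (K b s s' : RR) :
  (forall t, 0 <= t <= b -> t * complex.Re z <= K) ->
  0 <= s <= b -> 0 <= s' <= b ->
  `|rotRe th (cexp (s'%:C%C * z) * c) - rotRe th (cexp (s%:C%C * z) * c)
    - (s' - s) * rotRe th (z * (cexp (s%:C%C * z) * c))| <=
  expR K * normc (z * (z * c)) * (s' - s) ^+ 2.
Proof.
move=> zK s0 s'0.
have zc t : z * (cexp (t%:C%C * z) * c) = cexp (t%:C%C * z) * (z * c) by ring.
apply: (@taylor2_bound _ (fun t => rotRe th (cexp (t%:C%C * z) * c)) (fun t => rotRe th (z * (cexp (t%:C%C * z) * c)))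
  (fun t => rotRe th (z * (cexp (t%:C%C * z) * (z * c)))) _ b s s' s0 s'0) => t.
- exact: is_derive_rotRe_cexp.
- have := is_derive_rotRe_cexp th z (z * c) t; congr (is_derive _ _ _ _).
  by apply/funext => u; rewrite zc.
- move=> t0; rewrite (le_trans (rotRe_le _ _))//.
  rewrite (_ : z * (cexp (t%:C%C * z) * (z * c)) = cexp (t%:C%C * z) * (z * (z * c))); last by ring.
  by rewrite [leLHS]Normc.normcM ler_wpM2r ?normc_ge0// normc_cexp ler_expR ReZ zK.
Qed.

End cexp_facts.

Section multiplier_semigroup.
Variables (m F : RR -> RR[i]).
Hypothesis mm : cmeasurable (m : measurableTypeR RR -> RR[i]).
Hypothesis m0 : forall xi, complex.Re (m xi) <= 0.

Lemma cmeasurable_cexpM (s : RR) :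
  cmeasurable ((fun xi => cexp (s%:C%C * m xi)) : measurableTypeR RR -> RR[i]).
Proof. by apply: cmeasurable_cexp; apply: cmeasurableM => //; exact: cmeasurable_cst. Qed.

Lemma normc_cexpM_le1 (s : RR) xi : 0 <= s -> normc (cexp (s%:C%C * m xi)) <= 1.
Proof. by move=> s0; rewrite normc_cexp_le1// ReZ mulr_ge0_le0. Qed.

Lemma cintegrable_cexpM (s : RR) G : 0 <= s -> cintegrable G ->
  cintegrable (fun xi => cexp (s%:C%C * m xi) * G xi).
Proof.
move=> s0 Gi; apply: (@cintegrableM_bounded _ 1) => //.
  exact: cmeasurable_cexpM.
by move=> xi; exact: normc_cexpM_le1.
Qed.

Hypothesis F0 : cintegrable F.
Hypothesis F1 : cintegrable (fun xi => m xi * F xi).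
Hypothesis F2 : cintegrable (fun xi => m xi * (m xi * F xi)).

(** Differentiation in time of the semigroup with multiplier exp (s m): the
    pointwise estimate [rotRe_cexp_taylor2] is integrated.  The bound is uniform
    in time because Re m <= 0. *)
Lemma inv_ft_cexp_taylor2 x (s s' : RR) : 0 <= s -> 0 <= s' ->
  `|inv_ft (fun xi => cexp (s'%:C%C * m xi) * F xi) x
    - inv_ft (fun xi => cexp (s%:C%C * m xi) * F xi) x
    - (s' - s) * inv_ft (fun xi => cexp (s%:C%C * m xi) * (m xi * F xi)) x| <=
  (2 * pi)^-1 * \int[mu]_xi normc (m xi * (m xi * F xi)) * (s' - s) ^+ 2.
Proof.
move=> s0 s'0; have [_ F2i] := F2.
have p0 : 0 <= (2 * pi)^-1 :> RR by rewrite invr_ge0 mulr_ge0// pi_ge0.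
have i0 := L1_rotRe x (cintegrable_cexpM s0 F0).
have i0' := L1_rotRe x (cintegrable_cexpM s'0 F0).
have i1 := L1_rotRe x (cintegrable_cexpM s0 F1).
rewrite /inv_ft -mulrBr [(s' - s) * _]mulrCA -mulrBr normrM ger0_norm// -mulrA ler_wpM2l//.
rewrite -RintegralB// -(RintegralZl _ measurableT i1) -RintegralB//; last 2 first.
- exact: L1B.
- exact: L1Z.
rewrite -RintegralZr//; apply: le_norm_Rintegral.
- by under eq_fun do rewrite mulrC; exact: L1Z.
- apply: (@L1_measurable _ _ _ mu); apply: L1B; [exact: L1B|exact: L1Z].
move=> xi; have zK t : 0 <= t <= Num.max s s' -> t * complex.Re (m xi) <= 0.
  by case/andP => t0 _; rewrite mulr_ge0_le0.
have := @rotRe_cexp_taylor2 (x * xi) (m xi) (F xi) 0 (Num.max s s') s s' zK.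
rewrite s0 s'0 !le_max !lexx orbT expR0 mul1r => /(_ isT isT).
by rewrite (_ : m xi * (cexp _ * _) = cexp (s%:C%C * m xi) * (m xi * F xi))//; ring.
Qed.

End multiplier_semigroup.

(** * The symbol of the Riesz-Feller derivative *)

Section psi_facts.
Variables alpha theta : RR.

Lemma psiE xi : psi alpha theta xi =
  ((`|xi| `^ alpha * cos (Num.sg xi * theta * pi / 2)) +i*
   (`|xi| `^ alpha * sin (Num.sg xi * theta * pi / 2)))%C.
Proof.
rewrite /psi /cexp [complex.Re _]/= [complex.Im _]/= expR0 !mul1r.
by apply/eqP; rewrite eq_complex/= !mul0r subr0 addr0 !eqxx.
Qed.

Lemma normc_psi xi : normc (psi alpha theta xi) = `|xi| `^ alpha.
Proof.
rewrite psiE /= !exprMn -mulrDr cos2Dsin2 mulr1 sqrtr_sqr.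
by rewrite ger0_norm// powR_ge0.
Qed.

Lemma measurable_sgr : measurable_fun [set: measurableTypeR RR] (@Num.sg RR).
Proof.
have -> : @Num.sg RR = (fun x => \1_(`]0, +oo[ : set RR) x - \1_(`]-oo, 0[ : set RR) x).
  apply/funext => x; rewrite !indicE !mem_setE !in_itv/= andbT.
  by case: sgrP => h; rewrite ?ltxx ?h ?(ltNge 0) ?(ltNge x) ?(ltW h)//= ?subr0 ?sub0r.
by apply: measurable_funB; apply: measurable_indic.
Qed.

Lemma cmeasurable_psi : cmeasurable (psi alpha theta : measurableTypeR RR -> RR[i]).
Proof.
have mp : measurable_fun [set: measurableTypeR RR] (fun xi : RR => `|xi| `^ alpha).
  exact: (measurableT_comp (@measurable_powR RR alpha) (@normr_measurable RR setT)).
have ms : measurable_fun [set: measurableTypeR RR]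
    (fun xi : RR => Num.sg xi * theta * pi / 2).
  by do 3! apply: measurable_funM => //; exact: measurable_sgr.
rewrite (funext psiE); split; apply: measurable_funM => //=.
- exact: (measurableT_comp (@measurable_cos RR)).
- exact: (measurableT_comp (@measurable_sin RR)).
Qed.

Hypothesis htheta : `|theta| <= Num.min alpha (2 - alpha).

(** The condition on [theta] forces |theta| <= 1, so the argument of psi is at most
    pi / 2 in absolute value. *)
Lemma Re_psi_ge0 xi : 0 <= complex.Re (psi alpha theta xi).
Proof.
rewrite psiE/= mulr_ge0 ?powR_ge0//; apply: cos_ge0_pihalf.
have t1 : `|theta| <= 1.
  rewrite (le_trans htheta)// ge_min; apply/orP.
  have [a1|/ltW a1] := leP alpha 1; [by left|right].
  by rewrite lerBlDr -[X in X <= _]/(1 + 1) lerD2l.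
rewrite -ler_norml -mulrA normrM (ger0_norm (x := pi / 2)) ?divr_ge0 ?pi_ge0//.
rewrite ler_piMl ?divr_ge0 ?pi_ge0// normrM mulr_ile1// normr_sg.
by case: (xi != 0).
Qed.

End psi_facts.

Section psi_opp.
Variables alpha theta : RR.

Lemma cmeasurable_Npsi :
  cmeasurable ((fun xi => - psi alpha theta xi) : measurableTypeR RR -> RR[i]).
Proof.
rewrite (_ : (fun _ => _) = (fun xi => -1 * psi alpha theta xi)); last first.
  by apply/funext => xi; rewrite mulN1r.
by apply: cmeasurableM; [exact: cmeasurable_cst|exact: cmeasurable_psi].
Qed.

Lemma Re_Npsi_le0 xi : `|theta| <= Num.min alpha (2 - alpha) ->
  complex.Re (- psi alpha theta xi) <= 0.
Proof.
move=> /Re_psi_ge0/(_ xi).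
by case: (psi _ _ _) => p q /=; rewrite oppr_le0.
Qed.

End psi_opp.

Section decay.
Variables alpha theta : RR.
Hypothesis alpha0 : 0 < alpha.

Lemma normc_ft_le (g : RR -> RR) xi : mu.-L1 g ->
  normc (ft g xi) <= 2 * \int[mu]_y `|g y|.
Proof.
move=> gi.
have le th : `|rotRe th (ft g xi)| <= \int[mu]_y `|g y|.
  rewrite rotRe_ft//; apply: le_norm_Rintegral; first exact: L1_norm.
    apply: (@L1_measurable _ _ _ mu); apply: L1_cosM => //.
    by apply: measurable_funB => //; exact: measurable_funM.
  by move=> y; rewrite normrM ler_piMl// cos_max.
have hr := le 0; have hi := le (pi / 2); rewrite -Re_rotRe in hr; rewrite -Im_rotRe in hi.
case: (ft g xi) hr hi => a b /= ha hb.
apply: (@le_trans _ _ (`|a| + `|b|)); last by rewrite mulrDl mul1r lerD.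
rewrite -[leRHS]ger0_norm ?addr_ge0// -sqrtr_sqr ler_wsqrtr//.
by rewrite sqrrD !real_normK ?num_real// lerD2r lerDl mulrn_wge0// mulr_ge0.
Qed.

Lemma sq_le_powR (x : RR) k : 2 <= alpha * k%:R -> 1 <= `|x| ->
  x ^+ 2 <= (`|x| `^ alpha) ^+ k.
Proof.
move=> ak x1; rewrite -(powR_mulrn k (powR_ge0 _ _)) -powRrM -(real_normK (num_real x)).
by rewrite -(powR_mulrn 2)// ler_powR.
Qed.

(** As |psi(xi)|^k = |xi|^(alpha k) >= xi^2 for |xi| >= 1, the two bounds give
    |F(xi)| <= (2 A + B) / (1 + xi^2), and the right-hand side is a multiple of the
    Poisson kernel of width 1. *)
Lemma cintegrable_decay (F : RR -> RR[i]) (A B : RR) k :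
  cmeasurable (F : measurableTypeR RR -> RR[i]) ->
  2 <= alpha * k%:R ->
  (forall xi, normc (F xi) <= A) ->
  (forall xi, normc (psi alpha theta xi ^+ k * F xi) <= B) ->
  cintegrable F.
Proof.
move=> mF ak FA FB.
apply: (@le_cintegrable _ (fun xi => (2 * A + B) / 2 * poisson_kernel 1 xi)) => //.
  apply: L1Z; have := L1_poisson_kernel 0 (ltr01 : 0 < (1 : RR)).
  by under eq_fun do rewrite subr0.
move=> xi.
have A0 := le_trans (normc_ge0 _) (FA xi).
have B0 := le_trans (normc_ge0 _) (FB xi).
rewrite /poisson_kernel mulr1 expr1n mulrA divfK//.
rewrite ler_pdivlMr ?ltr_pwDl ?sqr_ge0// mulrDr mulr1.
have [x1|/ltW x1] := leP 1 `|xi|.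
  rewrite mulrDl mul1r -addrA lerD//.
  rewrite -[leLHS]add0r lerD// (le_trans _ (FB xi))//.
  rewrite Normc.normcM mulrC ler_wpM2r ?normc_ge0//.
  by rewrite normcX normc_psi sq_le_powR.
rewrite -[leLHS]addr0 lerD// mulrDl mul1r lerD//.
rewrite -[leRHS]mulr1 ler_pM ?normc_ge0 ?sqr_ge0//.
by rewrite -(real_normK (num_real xi)) expr_le1.
Qed.

End decay.

(** * The exponential series *)

Lemma cvg_expn_fact (K x : RR) : K * x ^+ n / n`!%:R @[n --> \oo] --> (0 : RR).
Proof.
rewrite -(mulr0 K).
have -> : (fun n => K * x ^+ n / n`!%:R) = (fun n => K * exp_coeff x n).
  by apply/funext => n; rewrite /exp_coeff /= mulrA.
apply: cvgM; first exact: cvg_cst.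
exact: cvg_series_cvg_0 (is_cvg_series_exp_coeff x).
Qed.

(** Taylor's formula on [0, 1] for the functions s |-> Re (exp (- i th) exp (s w)
    w^k c), each of which is the derivative of the preceding one. *)
Lemma cexp_series th (w c : RR[i]) :
  \sum_(0 <= k < n) rotRe th (w ^+ k * c) / k`!%:R @[n --> \oo]
    --> rotRe th (cexp w * c).
Proof.
pose F k (s : RR) := rotRe th (cexp (s%:C%C * w) * (w ^+ k * c)).
pose K := `|complex.Re w|.
have tK t : 0 <= t <= 1 -> t * complex.Re w <= K.
  case/andP => t0 t1; rewrite (le_trans (ler_norm _))// normrM ger0_norm//.
  by rewrite ler_piMl.
have Fd k : quadratic_derivative 1 (F k) (F k.+1).
  exists (expR K * normc (w * (w * (w ^+ k * c)))) => s s' s0 s'0.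
  have := @rotRe_cexp_taylor2 th w (w ^+ k * c) K 1 s s' tK s0 s'0.
  by rewrite (_ : w * (cexp _ * _) = cexp (s%:C%C * w) * (w ^+ k.+1 * c))// exprS; ring.
have FM n s : 0 <= s <= 1 -> `|F n s| <= expR K * normc c * normc w ^+ n.
  move=> s01; rewrite (le_trans (rotRe_le _ _))// !Normc.normcM normcX -mulrA.
  rewrite (mulrC (normc c)) ler_wpM2r ?mulr_ge0 ?normc_ge0 ?exprn_ge0 ?normc_ge0//.
  by rewrite normc_cexp ler_expR ReZ tK.
have FE n : \sum_(0 <= k < n) rotRe th (w ^+ k * c) / k`!%:R =
    \sum_(0 <= k < n) 1 ^+ k / k`!%:R * F k 0.
  by apply: eq_bigr => k _; rewrite expr1n /F mul0r cexp0 !mul1r mulrC.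
have F1 : F 0%N 1 = rotRe th (cexp w * c) by rewrite /F mul1r expr0 mul1r.
rewrite -F1; under eq_fun do rewrite FE.
have c0 := cvg_expn_fact (expR K * normc c) (normc w).
apply/cvgrPdist_le => e e0.
move/cvgrPdist_le : c0 => /(_ e e0) c0; near=> n.
have := @taylor_sup _ 1 n F _ 1 Fd (FM n); rewrite ler01 lexx => /(_ isT) H.
rewrite (le_trans H)// expr1n mulr1.
have : `|0 - expR K * normc c * normc w ^+ n / n`!%:R| <= e.
  by near: n.
by rewrite sub0r normrN; exact/le_trans/ler_norm.
Unshelve. all: by end_near. Qed.

(** * Averages of translates *)

Section averages.
Context {d : measure_display} {T : measurableType d} (P : probability T RR).
Variable X : T -> RR.
Hypothesis mX : measurable_fun setT X.

Lemma charfunE xi : charfun P X xi =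
  ((\int[P]_w cos (xi * X w)) +i* (\int[P]_w sin (xi * X w)))%C.
Proof. by rewrite /charfun unlock. Qed.

(** The transition operator of a process with independent stationary increments,
    when [X] is its value at a given time. *)
Definition avg (g : RR -> RR) (x : RR) : RR := \int[P]_w g (x - X w).

Lemma Rintegral_rotRe_charfun th xi z :
  \int[P]_w rotRe (th - xi * X w) z = rotRe th (charfun P X xi * z).
Proof.
have mc : P.-L1 (fun w => cos (xi * X w)).
  apply: (@L1_bounded _ _ _ _ _ 1) => [|w]; last exact: cos_max.
  by apply: (measurableT_comp (@measurable_cos RR)); exact: measurable_funM.
have ms : P.-L1 (fun w => sin (xi * X w)).
  apply: (@L1_bounded _ _ _ _ _ 1) => [|w]; last exact: sin_max.
  by apply: (measurableT_comp (@measurable_sin RR)); exact: measurable_funM.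
rewrite charfunE; case: z => a b; rewrite /rotRe /=.
set C := \int[P]_w cos _; set S := \int[P]_w sin _.
transitivity (\int[P]_w ((cos th * a + sin th * b) * cos (xi * X w) +
                         (sin th * a - cos th * b) * sin (xi * X w))).
  by apply: eq_Rintegral => w _; rewrite cosB sinB; ring.
rewrite RintegralD//; [|exact: L1Z|exact: L1Z].
by rewrite !RintegralZl// -/C -/S; ring.
Qed.

End averages.

Section averages_transform.
Context {d : measure_display} {T : measurableType d} (P : probability T RR).
Variable X : T -> RR.
Hypothesis mX : measurable_fun setT X.
Notation TR := (measurableTypeR RR).

Let mX' : @measurable_fun _ _ T TR setT X := mX.

Lemma continuous_translate (g : RR -> RR) z : continuous g ->
  continuous (fun x => g (x - z)).
Proof.
move=> cg x; apply: (@continuous_comp _ _ _ (fun x => x - z) g); last exact: cg.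
by apply: cvgB; [exact: cvg_id|exact: cvg_cst].
Qed.

Lemma measurable_translate (g : RR -> RR) x : continuous g ->
  measurable_fun setT (fun w => g (x - X w)).
Proof.
move=> cg; have mg : measurable_fun [set: TR] g by exact: continuous_measurable_fun.
apply: (measurableT_comp mg).
by apply: measurable_funB.
Qed.

Lemma avg_continuous (g : RR -> RR) M : continuous g ->
  (forall x, `|g x| <= M) -> continuous (avg P X g).
Proof.
move=> cg gM; apply: (@continuous_Rintegral_param _ T RR P _ (cst M)).
- by move=> x; exact: measurable_translate.
- by move=> w; exact: continuous_translate.
- exact: finite_measure_integrable_cst.
- by move=> x w; exact: gM.
Qed.

Lemma avg_le (g : RR -> RR) M x : continuous g ->
  (forall x, `|g x| <= M) -> `|avg P X g x| <= M.
Proof.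
move=> cg gM; apply: le_Rintegral_prob; first exact: measurable_translate.
by move=> w; exact: gM.
Qed.

(** The transform of a convolution is the product of the transforms: Fubini's
    theorem, then a translation by [X w] in the inner integral. *)
Lemma ft_avg (g : RR -> RR) M : continuous g -> (forall x, `|g x| <= M) ->
  mu.-L1 g ->
  mu.-L1 (avg P X g) /\
  forall xi, ft (avg P X g) xi = charfun P X xi * ft g xi.
Proof.
move=> cg gM gi.
pose k th xi w x := cos (x * xi - th) * g (x - X w).
have mc th xi : measurable_fun [set: TR] (fun x : RR => x * xi - th).
  by apply: measurable_funB => //; exact: measurable_funM.
have mk th xi : measurable_fun [set: T * TR] (fun z => k th xi z.1 z.2).
  apply: measurable_funM.
    apply: (measurableT_comp (@measurable_cos RR)).
    by apply: measurable_funB => //; exact: measurable_funM.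
  have mg : measurable_fun [set: TR] g by exact: continuous_measurable_fun.
  apply: (measurableT_comp mg); apply: measurable_funB => //.
  exact: (measurableT_comp mX').
have gt w : mu.-L1 (fun x => g (x - X w)) by exact: L1_translate.
have k1 th xi w : mu.-L1 (k th xi w) by exact: L1_cosM.
have k2 th xi x : P.-L1 (k th xi ^~ x).
  apply: (@L1_bounded _ _ _ _ _ M).
    by apply: measurable_funM => //; exact: measurable_translate.
  by move=> w; rewrite normrM (le_trans _ (gM (x - X w)))// ler_piMl// cos_max.
have k3 th xi w : \int[mu]_x `|k th xi w x| <= \int[mu]_x `|g x|.
  rewrite -(Rintegral_translate (X w) (continuous_normf cg) (L1_norm gi)).
  apply: le_Rintegral => //.
  - exact: (L1_norm (k1 th xi w)).
  - exact: (L1_norm (gt w)).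
  - by move=> x _; rewrite normrM ler_piMl// cos_max.
have k4 : P.-L1 (fun=> \int[mu]_x `|g x|) by exact: finite_measure_integrable_cst.
have F th xi := RFubini (mk th xi) (k1 th xi) (k2 th xi) (k3 th xi) k4.
have ai : mu.-L1 (avg P X g).
  have [_ + _] := F 0 0; apply: eq_integrable => // x _ /=; congr EFin.
  by apply: eq_Rintegral => w _; rewrite /k mulr0 subr0 cos0 mul1r.
split=> // xi.
have E th : rotRe th (ft (avg P X g) xi) = rotRe th (charfun P X xi * ft g xi).
  have [_ _ Fe] := F th xi.
  rewrite rotRe_ft// -Rintegral_rotRe_charfun//.
  transitivity (\int[mu]_x \int[P]_w k th xi w x).
    apply: eq_Rintegral => x _; rewrite /k RintegralZl//.
    apply: (@L1_bounded _ _ _ _ _ M) => //; exact: measurable_translate.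
  rewrite -Fe; apply: eq_Rintegral => w _.
  rewrite rotRe_ft//.
  rewrite -(@Rintegral_translate _ (fun y => cos (y * xi - (th - xi * X w)) * g y) (X w)).
  - by apply: eq_Rintegral => x _; rewrite /k; congr (cos _ * _); ring.
  - move=> x; apply: cvgM; last exact: cg.
    apply: (@continuous_comp _ _ _ (fun y : RR => y * xi - (th - xi * X w))).
      apply: cvgB; last exact: cvg_cst.
      exact: mulrr_continuous.
    exact: continuous_cos.
  - by apply: L1_cosM.
have := E 0; have := E (pi / 2); rewrite -!Re_rotRe -!Im_rotRe.
by case: (ft _ _) (charfun _ _ _ * _) => [? ?] [? ?] /= -> ->.
Qed.

(** The same rule for functions given by their transform, which need not be
    integrable themselves. *)
Lemma avg_inv_ft F x : cintegrable F ->
  avg P X (inv_ft F) x = inv_ft (fun xi => charfun P X xi * F xi) x.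
Proof.
move=> Fi; have [mF ni] := Fi.
pose k w xi := rotRe (x * xi - xi * X w) (F xi).
have mF1 : @cmeasurable _ _ (T * TR)%type (fun z => F z.2).
  by case: mF => m1 m2; split; [exact: (measurableT_comp m1)|
    exact: (measurableT_comp m2)].
have mk : measurable_fun [set: T * TR] (fun z => k z.1 z.2).
  apply: measurable_rotRe => //; apply: measurable_funB => //.
    exact: measurable_funM.
  by apply: measurable_funM => //; exact: (measurableT_comp mX').
have k1 w : mu.-L1 (k w).
  have := L1_rotRe (x - X w) Fi; apply: eq_integrable => // xi _ /=.
  by congr (EFin (rotRe _ _)); ring.
have k2 xi : P.-L1 (k ^~ xi).
  apply: (@L1_bounded _ _ _ _ _ (normc (F xi))); last by move=> w; exact: rotRe_le.
  apply: measurable_rotRe; first exact: cmeasurable_cst.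
  by apply: measurable_funB => //; exact: measurable_funM.
have k3 w : \int[mu]_xi `|k w xi| <= \int[mu]_xi normc (F xi).
  apply: le_Rintegral => //; first exact: (L1_norm (k1 w)).
  by move=> xi _; exact: rotRe_le.
have k4 : P.-L1 (fun=> \int[mu]_xi normc (F xi)) by exact: finite_measure_integrable_cst.
have [i1 _ Fe] := RFubini mk k1 k2 k3 k4.
rewrite /avg /inv_ft.
transitivity (\int[P]_w ((2 * pi)^-1 * \int[mu]_xi k w xi)).
  apply: eq_Rintegral => w _; congr (_ * _); apply: eq_Rintegral => xi _.
  by rewrite /k; congr (rotRe _ _); ring.
rewrite RintegralZl// Fe; congr (_ * _); apply: eq_Rintegral => xi _.
exact: Rintegral_rotRe_charfun.
Qed.

End averages_transform.

(** * The subordinated process *)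

Section subordination.
Variables alpha theta a lambda : RR.
Hypothesis ha : 0 <= a.
Hypothesis hlambda : 0 < lambda.
Context {d : measure_display} {T : measurableType d} (P : probability T RR).
Variables (S : RR -> {RV P >-> RR}) (N : RR -> {RV P >-> nat}).
Hypothesis hS : stable_process alpha theta S.
Hypothesis hN : poisson_process lambda N.
Hypothesis hSN : independent_processes P S N.

Definition subordinated (t : RR) (w : T) : RR := S (a * t + (N t w)%:R) w.

(** The characteristic exponent of the subordinated process. *)
Definition levy_symbol (xi : RR) : RR[i] :=
  - (a%:C%C * psi alpha theta xi) +
  lambda%:C%C * (cexp (- psi alpha theta xi) - 1).

Lemma measurable_count t k : measurable [set w | N t w = k].
Proof.
rewrite (_ : [set _ | _] = N t @^-1` [set k])//.
by rewrite -[X in measurable X]setTI; exact: measurable_funP.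
Qed.

Lemma poisson_marginal t k : 0 <= t ->
  fine (P [set w | N t w = k]) = expR (- (lambda * t)) * ((lambda * t) ^+ k / k`!%:R).
Proof.
move=> t0; have [N0 _ /(_ 0 t k (lexx _) t0)] := hN; rewrite subr0 => Pk.
suff -> : P [set w | N t w = k] = P [set w | N t w = (N 0 w + k)%N].
  by rewrite Pk/= mulrA.
have mE : measurable [set w | N t w = (N 0 w + k)%N].
  rewrite (_ : [set _ | _] = \bigcup_j ([set w | N 0 w = j] `&`
      [set w | N t w = (j + k)%N])).
    by apply: bigcup_measurable => j _; apply: measurableI; exact: measurable_count.
  by apply/seteqP; split=> [w /= E|w [j _ [/= <- //]]]; exists (N 0 w).
have mE' := measurable_count t k.
have PE A : measurable A -> P A = (\int[P]_w (\1_A w)%:E)%E.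
  by move=> mA; rewrite integral_indic// setIT.
rewrite (PE _ mE') (PE _ mE).
apply: ae_eq_integral => //; [exact/measurable_EFinP|exact/measurable_EFinP|].
apply: filterS N0 => w w0 _ /=; congr EFin; rewrite !indicE.
by congr (nat_of_bool _)%:R; apply/idP/idP; rewrite !inE/= w0 add0n.
Qed.

Lemma independent_marginals s t k B : 0 <= s -> 0 <= t -> measurable B ->
  P (S s @^-1` B `&` [set w | N t w = k]) =
  (P (S s @^-1` B) * P [set w | N t w = k])%E.
Proof.
move=> s0 t0 mB; apply: hSN; apply: sub_sigma_algebra.
  by exists s, B.
by exists t, [set k].
Qed.

Lemma subordinated_time_ge0 t (k : nat) : 0 <= t -> 0 <= a * t + k%:R.
Proof. by move=> t0; rewrite addr_ge0// mulr_ge0. Qed.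

Lemma measurable_subordinated t : measurable_fun setT (subordinated t).
Proof.
exact: (@measurable_random_index _ _ _ P (fun k => S (a * t + k%:R)) (N t)
  (measurable_count t)).
Qed.

Lemma cvg_subordinated_mean (f : RR -> RR) M t : 0 <= t ->
  measurable_fun setT f -> (forall y, `|f y| <= M) ->
  expR (- (lambda * t)) * \sum_(0 <= k < n) (lambda * t) ^+ k / k`!%:R *
    \int[P]_w f (S (k%:R + a * t) w)
    @[n --> \oo] --> \int[P]_w f (subordinated t w).
Proof.
move=> t0 mf fM.
have := @cvg_Rintegral_random_index _ _ _ P (fun k => S (a * t + k%:R)) (N t)
  (measurable_count t)
  (fun k B => independent_marginals k (subordinated_time_ge0 k t0) t0) f M mf fM.
rewrite [X in X @ \oo --> _ -> _](_ : _ = fun n => expR (- (lambda * t)) *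
  \sum_(0 <= k < n) (lambda * t) ^+ k / k`!%:R *
    \int[P]_w f (S (k%:R + a * t) w))//.
apply/funext => n; rewrite mulr_sumr; apply: eq_bigr => k _.
by rewrite poisson_marginal// (addrC k%:R); ring.
Qed.

Lemma charfun_stable s xi : 0 <= s ->
  charfun P (S s) xi = cexp (- (s%:C%C * psi alpha theta xi)).
Proof. by move=> s0; have [_ ->] := hS. Qed.

Lemma rotRe_charfun (X : T -> RR) th xi : measurable_fun setT X ->
  \int[P]_w rotRe (th - xi * X w) 1 = rotRe th (charfun P X xi).
Proof. by move=> mX; rewrite Rintegral_rotRe_charfun// mulr1. Qed.

Lemma cexpN_natmul z k : cexp (- (k%:R * z)) = cexp (- z) ^+ k.
Proof.
elim: k => [|k IH]; first by rewrite mul0r oppr0 cexp0 expr0.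
by rewrite exprSr -IH -cexpD -natr1 mulrDl mul1r opprD.
Qed.

(** Conditionally on the Poisson count k the characteristic function is
    exp (- (a t + k) psi); its Poisson mixture is an exponential series. *)
Lemma charfun_subordinated t xi : 0 <= t ->
  charfun P (subordinated t) xi = cexp (t%:C%C * levy_symbol xi).
Proof.
move=> t0; set p := psi alpha theta xi.
pose w := (lambda * t)%:C%C * cexp (- p).
pose c := cexp (- (lambda * t)%:C%C) * cexp (- ((a * t)%:C%C * p)).
have wc : cexp w * c = cexp (t%:C%C * levy_symbol xi).
  rewrite /c -!cexpD; congr cexp; rewrite /w /levy_symbol -/p !rmorphM/=; ring.
have E th : rotRe th (charfun P (subordinated t) xi) = rotRe th (cexp w * c).
  rewrite -rotRe_charfun; last exact: measurable_subordinated.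
  have mf : measurable_fun [set: RR] (fun y : RR => rotRe (th - xi * y) 1).
    apply: measurable_rotRe; first exact: cmeasurable_cst.
    by apply: measurable_funB => //; exact: measurable_funM.
  have fM y : `|rotRe (th - xi * y) 1| <= 1.
    by rewrite (le_trans (rotRe_le _ _))// Normc.normc1.
  have := @cvg_subordinated_mean _ 1 t t0 mf fM.
  have -> : (fun n => expR (- (lambda * t)) * \sum_(0 <= k < n) (lambda * t) ^+ k / k`!%:R *
      \int[P]_w0 rotRe (th - xi * S (k%:R + a * t) w0) 1) =
      (fun n => \sum_(0 <= k < n) rotRe th (w ^+ k * c) / k`!%:R).
    apply/funext => n; rewrite mulr_sumr; apply: eq_bigr => k _.
    rewrite rotRe_charfun//.
    rewrite charfun_stable; last by rewrite addrC subordinated_time_ge0.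
    have -> : cexp (- ((k%:R + a * t)%:C%C * p)) =
        cexp (- p) ^+ k * cexp (- ((a * t)%:C%C * p)).
      rewrite -cexpN_natmul -cexpD; congr cexp.
      by rewrite rmorphD/= rmorph_nat; ring.
    have ec : cexp (- (lambda * t)%:C%C) = (expR (- (lambda * t)))%:C%C.
      by rewrite /cexp/= oppr0 cos0 sin0 mulr1 mulr0.
    have -> : w ^+ k * c = ((lambda * t) ^+ k * expR (- (lambda * t)))%:C%C *
        (cexp (- p) ^+ k * cexp (- ((a * t)%:C%C * p))).
      by rewrite /w /c ec exprMn !rmorphM/= !rmorphXn/= rmorphM/=; ring.
    by rewrite rotReZ; ring.
  move=> H; apply: (cvg_unique (@Rhausdorff RR) H); exact: cexp_series.
rewrite -wc; have := E 0; have := E (pi / 2); rewrite -!Re_rotRe -!Im_rotRe.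
by case: (charfun _ _ _) (_ * c) => [? ?] [? ?] /= -> ->.
Qed.

End subordination.

(** * Iterated Riesz-Feller derivatives *)

Lemma fourierE (g : RR -> RR) xi : continuous g -> mu.-L1 g ->
  fourier g xi = ft g xi.
Proof.
move=> cg gi.
have ct (trig : RR -> RR) : continuous trig ->
    continuous (fun x : RR => trig (x * xi) * g x).
  move=> ctrig x; apply: cvgM; last exact: cg.
  apply: (@continuous_comp _ _ _ (fun x : RR => x * xi) trig); last exact: ctrig.
  exact: mulrr_continuous.
have mx : measurable_fun [set: measurableTypeR RR] (fun x : RR => x * xi).
  exact: measurable_funM.
rewrite /fourier !improperE//; [exact/ct/continuous_sin|exact: L1_sinM|
  exact/ct/continuous_cos|exact: L1_cosM].
Qed.

Section smooth_domain.
Variables alpha theta : RR.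
Hypothesis alpha0 : 0 < alpha.
Variable f : RR -> RR.
Hypothesis fcont : continuous f.
Hypothesis fL1 : mu.-L1 f.
Notation iterD := (is_RieszFeller_iter alpha theta).

(** The Fourier transform of the [k]-th iterate applied to [f]. *)
Definition Fhat k xi := (- psi alpha theta xi) ^+ k * ft f xi.

Lemma FhatS k : (fun xi => - psi alpha theta xi * Fhat k xi) = Fhat k.+1.
Proof. by apply/funext => xi; rewrite /Fhat exprS mulrA. Qed.

Lemma iterD_ft n g : iterD n f g ->
  [/\ continuous g, mu.-L1 g & forall xi, ft g xi = Fhat n xi].
Proof.
elim: n g => [g ->|n IH g [h /IH[ch hi hE] [cg gLc gE]]].
  by split=> // xi; rewrite /Fhat expr0 mul1r.
have gi := Lc_L1 cg gLc; split=> // xi.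
by rewrite -fourierE// gE fourierE// hE /Fhat exprS mulrA.
Qed.

Hypothesis fD : forall n, exists g, iterD n f g.

(** The transforms of the iterates of orders [k] and [m + k] are bounded, the
    latter being psi^m times the former up to sign. *)
Lemma cintegrable_Fhat k : cintegrable (Fhat k).
Proof.
have [m ham] : exists m : nat, 2 <= alpha * m%:R.
  exists (Num.bound (2 / alpha)).
  by rewrite mulrC -ler_pdivrMr// ltW// archi_boundP// divr_ge0// ltW.
have [g /iterD_ft[_ gi gE]] := fD k.
have [g' /iterD_ft[_ gi' gE']] := fD (m + k).
apply: (@cintegrable_decay alpha theta _ (2 * \int[mu]_y `|g y|)
  (2 * \int[mu]_y `|g' y|) m) => //.
- by rewrite -(funext gE); exact: cmeasurable_ft.
- by move=> xi; rewrite -gE normc_ft_le.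
- move=> xi; rewrite (_ : normc _ = normc (ft g' xi)) ?normc_ft_le//.
  by rewrite gE' /Fhat exprD -mulrA !Normc.normcM !normcX normcN.
Qed.

(** Continuity of the iterate gives the value at every point, not only almost
    everywhere. *)
Lemma iterD_inv_ft n g x : iterD n f g -> g x = inv_ft (Fhat n) x.
Proof.
move=> /iterD_ft[cg gi gE].
have FE : ft g = Fhat n by exact/funext.
by rewrite -FE; apply: ft_inversion => //; rewrite FE; exact: cintegrable_Fhat.
Qed.

Lemma iterD_bounded n g : iterD n f g -> exists M, forall x, `|g x| <= M.
Proof.
move=> ng; exists ((2 * pi)^-1 * \int[mu]_xi normc (Fhat n xi)) => x.
by rewrite (iterD_inv_ft x ng); exact/inv_ft_le/cintegrable_Fhat.
Qed.

Section translation_average.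
Context {d : measure_display} {T : measurableType d} (P : probability T RR).
Variable X : T -> RR.
Hypothesis mX : measurable_fun setT X.

Lemma iterD_avg_facts n g : iterD n f g ->
  [/\ continuous (avg P X g), mu.-L1 (avg P X g) &
      forall xi, ft (avg P X g) xi = charfun P X xi * ft g xi].
Proof.
move=> ng; have [cg gi _] := iterD_ft ng; have [M gM] := iterD_bounded ng.
have [ai aE] := @ft_avg _ _ P X mX g M cg gM gi.
by split=> //; exact: avg_continuous gM.
Qed.

(** Both operators are Fourier multipliers. *)
Lemma RieszFeller_avg n h g : iterD n f h -> is_RieszFeller alpha theta h g ->
  is_RieszFeller alpha theta (avg P X h) (avg P X g).
Proof.
move=> nh hg; have ng : iterD n.+1 f g by exists h.
have [cah hai haE] := iterD_avg_facts nh.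
have [cag gai gaE] := iterD_avg_facts ng.
have [_ hi _] := iterD_ft nh; have [cg gi _] := iterD_ft ng.
have ch : continuous h by have [] := iterD_ft nh.
case: hg => _ _ hgE; split; [exact: cag|exact: (L1_Lc cag gai)|move=> xi].
rewrite !fourierE// haE gaE -(fourierE xi cg gi) hgE fourierE//.
by rewrite mulrCA.
Qed.

Lemma iterD_avg n g : iterD n f g -> iterD n (avg P X f) (avg P X g).
Proof.
elim: n g => [g -> //|n IH g [h nh hg]].
by exists (avg P X h); [exact: IH|exact: (RieszFeller_avg nh hg)].
Qed.

Lemma avg_iterD_inv_ft n g x : iterD n f g ->
  avg P X g x = inv_ft (fun xi => charfun P X xi * Fhat n xi) x.
Proof.
move=> ng; rewrite -avg_inv_ft//; last exact: cintegrable_Fhat.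
by apply: eq_Rintegral => w _; rewrite (iterD_inv_ft _ ng).
Qed.

End translation_average.

End smooth_domain.

(** * The shift operator is the stable semigroup at time one *)

Section shift_operator.
Variables alpha theta : RR.
Hypothesis alpha0 : 0 < alpha.
Hypothesis htheta : `|theta| <= Num.min alpha (2 - alpha).
Variable f : RR -> RR.
Hypothesis fcont : continuous f.
Hypothesis fL1 : mu.-L1 f.
Notation iterD := (is_RieszFeller_iter alpha theta).
Notation Fh := (Fhat alpha theta f).
Hypothesis fD : forall n, exists g, iterD n f g.

Context {d : measure_display} {T : measurableType d} (P : probability T RR).
Variable S : RR -> {RV P >-> RR}.
Hypothesis hS : stable_process alpha theta S.

Let Fi k : cintegrable (Fh k) := cintegrable_Fhat alpha0 fcont fL1 fD k.

Lemma stable_mean_inv_ft n g s x : iterD n f g -> 0 <= s ->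
  avg P (S s) g x =
  inv_ft (fun xi => cexp (s%:C%C * - psi alpha theta xi) * Fh n xi) x.
Proof.
move=> ng s0; have mS : measurable_fun setT (S s) by [].
rewrite (avg_iterD_inv_ft alpha0 fcont fL1 fD P mS x ng)//.
congr inv_ft; apply/funext => xi.
by rewrite (charfun_stable hS xi s0) mulrN.
Qed.

(** Taylor's formula for s |-> E f(x - S(s)), whose n-th derivative
    E g_n(x - S(s)) is at most sup |g_n|. *)
Lemma stable_taylor (g : nat -> RR -> RR) n M x :
  (forall k, iterD k f (g k)) -> (forall y, `|g n y| <= M) ->
  `|avg P (S 1) f x - \sum_(0 <= k < n) 1 ^+ k / k`!%:R * g k x| <= M / n`!%:R.
Proof.
move=> gk gM.
pose V k (s : RR) := inv_ft (fun xi => cexp (s%:C%C * - psi alpha theta xi) * Fh k xi) x.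
have FS := FhatS alpha theta f.
have Vd k : quadratic_derivative 1 (V k) (V k.+1).
  have F1 : cintegrable (fun xi => - psi alpha theta xi * Fh k xi) by rewrite FS.
  have F2 : cintegrable (fun xi => - psi alpha theta xi * (- psi alpha theta xi * Fh k xi)).
    by under eq_fun do rewrite [X in _ * X](congr1 (fun h => h _) (FS k)); rewrite FS.
  eexists => s s' /andP[s0 _] /andP[s'0 _].
  have := inv_ft_cexp_taylor2 (@cmeasurable_Npsi alpha theta)
    (fun xi => Re_Npsi_le0 xi htheta) (Fi k) F1 F2 x s0 s'0.
  have -> : (fun xi => cexp (s%:C%C * - psi alpha theta xi) * (- psi alpha theta xi * Fh k xi)) =
      (fun xi => cexp (s%:C%C * - psi alpha theta xi) * Fh k.+1 xi).
    by apply/funext => xi; rewrite -FS.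
  exact.
have Vb s : 0 <= s <= 1 -> `|V n s| <= M.
  move=> /andP[s0 _]; rewrite /V -(stable_mean_inv_ft x (gk n) s0).
  by apply: avg_le gM => //; have [] := iterD_ft fcont fL1 (gk n).
have V0 k : V k 0 = g k x.
  rewrite (iterD_inv_ft alpha0 fcont fL1 fD x (gk k)) /V; congr inv_ft.
  by apply/funext => xi; rewrite mul0r cexp0 mul1r.
have V1 : V 0%N 1 = avg P (S 1) f x.
  by rewrite /V -(@stable_mean_inv_ft 0 f).
have := taylor_sup Vd Vb; move=> /(_ 1); rewrite ler01 lexx => /(_ isT).
rewrite V1 expr1n mulr1.
by under eq_bigr do rewrite V0.
Qed.

(** Two consecutive partial sums of a uniformly convergent series are uniformly
    close, so sup |g_N| / N! is small, and [stable_taylor] shows that the partial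
    sums converge to the stable mean as well. *)
Lemma shift_is_stable_mean h : is_shift alpha theta 1 f h ->
  h = avg P (S 1) f.
Proof.
move=> [_ [g gk /uniform_cvgP gu]].
apply/funext => x; apply/eqP; rewrite -subr_eq0 -normr_le0.
apply/ler_addgt0Pl => e e0; rewrite addr0.
have e3 : 0 < e / 3 by rewrite divr_gt0.
have [N _ HN] := gu _ e3.
pose s n (x : RR) : RR := \sum_(0 <= k < n) 1 ^+ k / k`!%:R * g k x.
have HN0 y : `|h y - s N y| <= e / 3 by exact: HN N (leqnn N) y.
have HN1 y : `|h y - s N.+1 y| <= e / 3 by exact: HN N.+1 (leqnSn N) y.
have NF : 0 < N`!%:R :> RR by rewrite ltr0n fact_gt0.
have gM y : `|g N y| <= (e / 3 + e / 3) * N`!%:R.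
  have -> : g N y = ((h y - s N y) - (h y - s N.+1 y)) * N`!%:R.
    rewrite /s big_nat_recr//= expr1n; field.
    by rewrite gt_eqF.
  rewrite normrM (gtr0_norm NF) ler_pM2r//.
  by rewrite (le_trans (ler_normB _ _))// lerD.
have := stable_taylor x gk gM; rewrite mulfK ?gt_eqF// -/(s N x) => H.
rewrite (_ : h x - _ = (h x - s N x) - (avg P (S 1) f x - s N x)); last by ring.
rewrite (le_trans (ler_normB _ _))// (_ : e = e / 3 + (e / 3 + e / 3)); last by field.
by rewrite lerD.
Qed.

End shift_operator.

(** * The initial-value problem *)

Section symbol.
Variables alpha theta a lambda : RR.
Hypothesis htheta : `|theta| <= Num.min alpha (2 - alpha).
Hypothesis ha : 0 <= a.
Hypothesis hlambda : 0 < lambda.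
Notation m := (levy_symbol alpha theta a lambda).

Lemma Re_levy_symbol xi : complex.Re (m xi) <= 0.
Proof.
have p0 := Re_psi_ge0 htheta xi.
have e1 : complex.Re (cexp (- psi alpha theta xi)) <= 1.
  rewrite (le_trans (ler_norm _))// Re_rotRe (le_trans (rotRe_le _ _))//.
  by apply: normc_cexp_le1; exact: Re_Npsi_le0.
rewrite /levy_symbol; case: (psi alpha theta xi) (cexp _) p0 e1 => [p q] [c e] /= p0 c1.
have ap : 0 <= a * p by rewrite mulr_ge0.
have lc : 0 <= lambda * (1 - c) by rewrite mulr_ge0 ?subr_ge0// ltW.
by rewrite !mul0r !subr0; lra.
Qed.

Lemma cmeasurable_levy_symbol : cmeasurable (m : measurableTypeR RR -> RR[i]).
Proof.
have mN := @cmeasurable_Npsi alpha theta.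
rewrite /levy_symbol (_ : (fun _ => _) = (fun xi => a%:C%C * - psi alpha theta xi +
  lambda%:C%C * (cexp (- psi alpha theta xi) + -1))); last first.
  by apply/funext => xi; rewrite mulrN.
apply: cmeasurableD; apply: cmeasurableM => //; try exact: cmeasurable_cst.
by apply: cmeasurableD; [exact: cmeasurable_cexp|exact: cmeasurable_cst].
Qed.

Lemma cintegrable_levy_symbolM (F : RR -> RR[i]) : cintegrable F ->
  cintegrable (fun xi => - psi alpha theta xi * F xi) ->
  [/\ cintegrable (fun xi => cexp (- psi alpha theta xi) * F xi),
      cintegrable (fun xi => m xi * F xi) &
      (fun xi => m xi * F xi) = (fun xi =>
        a%:C%C * (- psi alpha theta xi * F xi) +
        ((- lambda)%:C%C * F xi + lambda%:C%C * (cexp (- psi alpha theta xi) * F xi)))].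
Proof.
move=> F0 F1.
have mN : cmeasurable ((fun xi => - psi alpha theta xi) : measurableTypeR RR -> RR[i]).
  exact: cmeasurable_Npsi.
have F2 : cintegrable (fun xi => cexp (- psi alpha theta xi) * F xi).
  apply: (@cintegrableM_bounded _ 1) => //; first exact: cmeasurable_cexp.
  by move=> xi; apply: normc_cexp_le1; exact: Re_Npsi_le0.
have mE : (fun xi => m xi * F xi) = (fun xi =>
    a%:C%C * (- psi alpha theta xi * F xi) +
    ((- lambda)%:C%C * F xi + lambda%:C%C * (cexp (- psi alpha theta xi) * F xi))).
  by apply/funext => xi; rewrite /levy_symbol rmorphN/=; ring.
split=> //; rewrite mE; apply: cintegrableD; first exact: cintegrableZ.
by apply: cintegrableD; exact: cintegrableZ.
Qed.

End symbol.

Theorem lemma8 (alpha theta a lambda : RR)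
  (halpha : 0 < alpha <= 2) (htheta : `|theta| <= Num.min alpha (2 - alpha))
  (ha : 0 <= a) (hlambda : 0 < lambda)
  (f : RR -> RR) (fcont : continuous f) (fLc : Lc f)
  (fD : forall j : nat, exists2 g : RR -> RR,
          is_RieszFeller_iter alpha theta j f g & Lc g)
  (fO : exists h : RR -> RR, is_shift alpha theta 1 f h)
  (d : measure_display) (T : measurableType d) (P : probability T RR)
  (S : RR -> {RV P >-> RR}) (N : RR -> {RV P >-> nat})
  (hS : stable_process alpha theta S) (hN : poisson_process lambda N)
  (hSN : independent_processes P S N) :
  let Z : RR -> T -> RR := fun t w => S (a * t + (N t w)%:R) w in
  let u : RR -> RR -> RR := fun x t => fine 'E_P[fun w => f (x - Z t w)] in
  [/\ forall x t, 0 <= t ->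
        P.-integrable setT (EFin \o (fun w => f (x - Z t w))),
      solves_ivp alpha theta a lambda f u,
      forall x t, 0 <= t ->
        expR (- (lambda * t)) * \sum_(0 <= k < n) (lambda * t) ^+ k / k`!%:R *
          \int[distribution P (S (k%:R + a * t))]_y f (x - y)
        @[n --> \oo] --> u x t &
      forall p : RR -> RR -> RR, transition_density S p ->
        forall x t, 0 <= t ->
          expR (- (lambda * t)) * \sum_(0 <= k < n) (lambda * t) ^+ k / k`!%:R *
            density_integral p (fun y => f (x - y)) (k%:R + a * t)
          @[n --> \oo] --> u x t].
Proof.
move=> Z u.
have alpha0 : 0 < alpha by case/andP: halpha.
have fL1 := Lc_L1 fcont fLc.
have fD' n : exists g, is_RieszFeller_iter alpha theta n f g.
  by have [g ng _] := fD n; exists g.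
have [h hh] := fO.
have mf : measurable_fun [set: RR] f by exact: continuous_measurable_fun.
have [M fM] := iterD_bounded alpha0 fcont fL1 fD' (erefl : is_RieszFeller_iter alpha theta 0 f f).
have mZ t : measurable_fun setT (Z t) by exact: (@measurable_subordinated a _ _ P S N t).
have uE x t : u x t = avg P (Z t) f x by rewrite /u unlock.
have mfx x : measurable_fun [set: RR] (fun y : RR => f (x - y)).
  by apply: (measurableT_comp mf); exact: measurable_funB.
have mean_cvg x t : 0 <= t ->
    expR (- (lambda * t)) * \sum_(0 <= k < n) (lambda * t) ^+ k / k`!%:R *
      \int[P]_w f (x - S (k%:R + a * t) w) @[n --> \oo] --> u x t.
  move=> t0; rewrite uE.
  exact: (cvg_subordinated_mean ha hN hSN t0 (mfx x) (fun y => fM (x - y))).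
have distE x s : \int[distribution P (S s)]_y f (x - y) = \int[P]_w f (x - S s w).
  rewrite /Rintegral integral_distribution//.
    by apply/measurable_EFinP; exact: mfx.
  have mS : measurable_fun setT (S s) by [].
  exact: (@L1_bounded _ _ _ P _ M (measurable_translate mS x fcont)
    (fun w => fM (x - S s w))).
have uF n g x t : is_RieszFeller_iter alpha theta n f g -> 0 <= t ->
    avg P (Z t) g x = inv_ft (fun xi =>
      cexp (t%:C%C * levy_symbol alpha theta a lambda xi) * Fhat alpha theta f n xi) x.
  move=> ng t0; rewrite (avg_iterD_inv_ft alpha0 fcont fL1 fD' P (mZ t) x ng).
  congr inv_ft; apply/funext => xi.
  by rewrite (charfun_subordinated ha hS hN hSN xi t0).
split.
- move=> x t t0.
  have mfZ := measurable_translate (mZ t) x fcont.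
  exact: (@L1_bounded _ _ _ P _ M mfZ (fun w => fM (x - Z t w))).
- split=> [x|t t0].
    (* the multiplier exp (t m) is 1 at t = 0 *)
    rewrite uE (uF 0%N f x 0 erefl (lexx _)).
    rewrite [RHS](iterD_inv_ft alpha0 fcont fL1 fD' (n := 0) _ erefl).
    by congr inv_ft; apply/funext => xi; rewrite mul0r cexp0 mul1r.
  have hE := shift_is_stable_mean alpha0 htheta fcont fL1 fD' hS hh.
  have [_ [g gk /uniform_cvgP gu]] := hh.
  have uEt : u ^~ t = avg P (Z t) f by apply/funext => x; exact: uE.
  exists (avg P (Z t) (g 1%N)), (avg P (Z t) h); split.
  + have [h0 /= h0E hg] := gk 1%N; rewrite h0E in hg.
    rewrite uEt; exact: (RieszFeller_avg alpha0 fcont fL1 fD' P (mZ t) (n := 0) erefl hg).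
  + have gb k : exists M', forall y, `|g k y| <= M'.
      exact: (iterD_bounded alpha0 fcont fL1 fD' (gk k)).
    have gc k : continuous (g k) by have [] := iterD_ft fcont fL1 (gk k).
    have gi x k : P.-L1 (fun w => g k (x - Z t w)).
      have [Mk gM] := gb k.
      exact: (@L1_bounded _ _ _ P _ Mk (measurable_translate (mZ t) x (gc k))
        (fun w => gM (x - Z t w))).
    have mS1 : measurable_fun setT (S 1) by [].
    have ch : continuous h by rewrite hE; exact: (avg_continuous mS1 fcont fM).
    have hM y : `|h y| <= M by rewrite hE; exact: (@avg_le _ _ P (S 1) mS1 f M y fcont fM).
    split.
      have [c1 c2 _] := iterD_avg_facts alpha0 fcont fL1 fD' P (mZ t) (n := 0) erefl.
      by rewrite uEt; exact: L1_Lc.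
    exists (fun k => avg P (Z t) (g k)).
      by move=> k; rewrite uEt; exact: (iterD_avg alpha0 fcont fL1 fD' P (mZ t) (gk k)).
    (* averaging does not increase the uniform distance to the sum *)
    apply/uniform_cvgP => e e0.
    apply: filterS (gu e e0) => n gn x.
    have si k : P.-L1 (fun w => 1 ^+ k / k`!%:R * g k (x - Z t w)).
      exact: L1Z.
    have [Si SE] := Rintegral_sum n si.
    have hi : P.-L1 (fun w => h (x - Z t w)).
      exact: (@L1_bounded _ _ _ P _ M (measurable_translate (mZ t) x ch)
        (fun w => hM (x - Z t w))).
    have -> : \sum_(0 <= k < n) 1 ^+ k / k`!%:R * avg P (Z t) (g k) x =
        \int[P]_w (\sum_(0 <= k < n) 1 ^+ k / k`!%:R * g k (x - Z t w)).
      by rewrite SE; apply: eq_bigr => k _; rewrite RintegralZl.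
    rewrite /avg -RintegralB//; apply: le_Rintegral_prob.
      exact: L1_measurable (L1B hi Si).
    by move=> w; exact: gn.
  + move=> x; rewrite /is_time_derivative.
    pose m := levy_symbol alpha theta a lambda.
    pose V1 s := inv_ft (fun xi => cexp (s%:C%C * m xi) * (m xi * Fhat alpha theta f 0 xi)) x.
    have Fi k := cintegrable_Fhat alpha0 fcont fL1 fD' k.
    have FS := FhatS alpha theta f.
    have Fi' k : cintegrable (fun xi => - psi alpha theta xi * Fhat alpha theta f k xi).
      by rewrite FS.
    have [eF0 mF0 mF0E] := @cintegrable_levy_symbolM alpha theta a lambda htheta _ (Fi 0%N) (Fi' 0%N).
    have [_ mF1 _] := @cintegrable_levy_symbolM alpha theta a lambda htheta _ (Fi 1%N) (Fi' 1%N).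
    have mmF0 : cintegrable (fun xi => m xi * (m xi * Fhat alpha theta f 0 xi)).
      have pmF0 : cintegrable (fun xi => - psi alpha theta xi * (m xi * Fhat alpha theta f 0 xi)).
        rewrite (_ : (fun _ => _) = (fun xi => m xi * Fhat alpha theta f 1 xi))//.
        by apply/funext => xi; rewrite -FS mulrCA.
      by have [] := @cintegrable_levy_symbolM alpha theta a lambda htheta _ mF0 pmF0.
    have mm : cmeasurable (m : measurableTypeR RR -> RR[i]) by exact: cmeasurable_levy_symbol.
    have m0 xi : complex.Re (m xi) <= 0 by exact: Re_levy_symbol.
    have qd : quadratic_derivative (t + 1) (u x) V1.
      eexists => s s' /andP[s0 _] /andP[s'0 _].
      rewrite !uE (uF 0%N f x _ erefl s0) (uF 0%N f x _ erefl s'0).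
      exact: (inv_ft_cexp_taylor2 mm m0 (Fi 0%N) mF0 mmF0 x s0 s'0).
    (* any end point beyond t makes the derivative at t two-sided for t > 0 *)
    have t1 : 0 <= t < t + 1 by rewrite t0 ltrDl ltr01.
    have := quadratic_derivative_cvg qd t1.
    rewrite (_ : V1 t = a * avg P (Z t) (g 1%N) x - lambda * (u x t - avg P (Z t) h x))//.
    have OuE : avg P (Z t) h x = inv_ft (fun xi => cexp (t%:C%C * m xi) *
        (cexp (- psi alpha theta xi) * Fhat alpha theta f 0 xi)) x.
      transitivity (avg P (Z t) (inv_ft (fun xi =>
          cexp (- psi alpha theta xi) * Fhat alpha theta f 0 xi)) x).
        apply: eq_Rintegral => w _; rewrite hE.
        rewrite (stable_mean_inv_ft alpha0 fcont fL1 fD' hS (n := 0) _ erefl ler01).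
        by congr inv_ft; apply/funext => xi; rewrite mul1r.
      rewrite (avg_inv_ft P (mZ t) x eF0); congr inv_ft; apply/funext => xi.
      by rewrite (charfun_subordinated ha hS hN hSN xi t0).
    have tm G : cintegrable G -> cintegrable (fun xi => cexp (t%:C%C * m xi) * G xi).
      exact: cintegrable_cexpM.
    rewrite uE (uF 0%N f x t erefl t0) (uF 1%N (g 1%N) x t (gk 1%N) t0) OuE.
    have -> : V1 t = inv_ft (fun xi =>
        a%:C%C * (cexp (t%:C%C * m xi) * Fhat alpha theta f 1 xi) +
        ((- lambda)%:C%C * (cexp (t%:C%C * m xi) * Fhat alpha theta f 0 xi) +
         lambda%:C%C * (cexp (t%:C%C * m xi) *
           (cexp (- psi alpha theta xi) * Fhat alpha theta f 0 xi)))) x.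
      congr inv_ft; apply/funext => xi.
      have := congr1 (fun F => F xi) mF0E; rewrite -/m /= => ->.
      by rewrite -FS; ring.
    have iF0 := tm _ (Fi 0%N); have iF1 := tm _ (Fi 1%N); have ieF0 := tm _ eF0.
    rewrite inv_ftD; [|exact: cintegrableZ|by apply: cintegrableD; exact: cintegrableZ].
    rewrite inv_ftD; [|exact: cintegrableZ|exact: cintegrableZ].
    by rewrite !inv_ftZ//; rewrite -/m; ring.
- move=> x t t0.
  rewrite [X in X @ \oo](_ : _ = fun n => expR (- (lambda * t)) *
    \sum_(0 <= k < n) (lambda * t) ^+ k / k`!%:R *
      \int[P]_w f (x - S (k%:R + a * t) w)); first exact: mean_cvg.
  by apply/funext => n; congr (_ * _); apply: eq_bigr => k _; rewrite distE.
- move=> p hp x t t0.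
  have densE s : 0 <= s -> density_integral p (fun y => f (x - y)) s =
      \int[P]_w f (x - S s w).
    rewrite /density_integral le_eqVlt => /predU1P[<-|s0].
      rewrite eqxx subr0.
      rewrite -[RHS]/(avg P (S 0) f x).
      rewrite (stable_mean_inv_ft alpha0 fcont fL1 fD' hS (n := 0) x erefl (lexx _)).
      rewrite [LHS](iterD_inv_ft alpha0 fcont fL1 fD' (n := 0) _ erefl).
      by congr inv_ft; apply/funext => xi; rewrite mul0r cexp0 mul1r.
    rewrite gt_eqF//; have [mp p0 pE] := hp s s0.
    have mi : @measurable_fun _ _ (measurableTypeR RR) RR setT id.
      by move=> _ B mB; rewrite setTI.
    have nu_fin : (distribution P (S s) setT < +oo)%E.
      by rewrite probability_setT ltry.
    rewrite -(@Rintegral_weighted _ _ (measurableTypeR RR) _ RR mu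
      (distribution P (S s)) id (p ^~ s) nu_fin mi mp p0 pE _ M (mfx x)
      (fun y => fM (x - y))).
    exact: distE.
  rewrite [X in X @ \oo](_ : _ = fun n => expR (- (lambda * t)) *
    \sum_(0 <= k < n) (lambda * t) ^+ k / k`!%:R *
      \int[P]_w f (x - S (k%:R + a * t) w)); first exact: mean_cvg.
  apply/funext => n; congr (_ * _); apply: eq_bigr => k _; rewrite densE//.
  by rewrite addr_ge0// mulr_ge0.
Qed.
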